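(* Let $Q$ be a rooted tree quiver. Let $\mathbf{rep}_{H_0}(Q)\subseteq \mathbf{rep}(Q)$ be the essential image of the zero-dimensional persistent homology functor $H_0:\mathbf{top}^Q\to\mathbf{rep}(Q)$, and let $\mathrm{add}(\mathbf{rep}_{H_0}(Q))$ be its additive closure. Then: (1) $\mathbf{rep}_{H_0}(Q)$ is the full subcategory of $\mathbf{rep}(Q)$ spanned by the objects isomorphic to finite direct sums of linearized rooted tree quivers over $Q$. (2) $\mathrm{add}(\mathbf{rep}_{H_0}(Q))$ is the full subcategory of $\mathbf{rep}(Q)$ spanned by the objects isomorphic to finite direct sums of rooted tree modules over $Q$.
   Context: Fix a field $\Bbbk$. All quivers are finite and all representations are finite dimensional over $\Bbbk$; finite direct sums may be empty (giving the zero representation). A tree quiver is a quiver whose underlying undirected graph is a tree (connected, no cycles). A rooted tree quiver is a tree quiver with exactly one vertex $\sigma$ of out-degree zero, called its root. A quiver morphism $f:Q'\to Q$ is a pair of functions on vertices and edges, $f_0$ and $f_1$, respecting sources and targets. A rooted tree quiver over a rooted tree quiver $Q$ is a pair $(T,f_T)$ with $T$ a rooted tree quiver and $f_T:T\to Q$ a quiver morphism sending the root of $T$ to the root of $Q$. $\mathbf{rep}(Q)$ is the category of representations of $Q$. The path category of $Q$ (also denoted $Q$) has as objects the vertices of $Q$ and as morphisms $x\to y$ the (possibly empty) directed paths from $x$ to $y$; $\mathbf{rep}(Q)$ is canonically equivalent to the category of functors from the path category of $Q$ to finite dimensional $\Bbbk$-vector spaces. $\mathbf{top}$ is the category of topological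 spaces with finitely many path-connected components, $\mathbf{top}^Q$ is the category of functors from the path category of $Q$ to $\mathbf{top}$, and $H_0:\mathbf{top}^Q\to\mathbf{rep}(Q)$ is post-composition with the zeroth homology functor $H_0(-;\Bbbk)$ followed by this equivalence. The additive closure of a collection of objects is formed by taking all (finite) direct sums of all direct summands of objects in the collection. For a quiver morphism $f:Q'\to Q$, the push-forward $f_*:\mathbf{rep}(Q')\to\mathbf{rep}(Q)$ is given by $f_*(V)_x=\bigoplus_{y\in f_0^{-1}(x)}V_y$ for each vertex $x$ and $f_*(V)_\alpha=\sum_{\beta\in f_1^{-1}(\alpha)}V_\beta$ for each arrow $\alpha$. The constant representation $\mathbb{1}_T$ has $\Bbbk$ at every vertex and the identity at every arrow. The linearization of $(T,f_T)$ is $\Bbbk_T:=(f_T)_*(\mathbb{1}_T)\in\mathbf{rep}(Q)$. A linearized rooted tree quiver over $Q$ is a representation of $Q$ isomorphic to $\Bbbk_T$ for some rooted tree quiver $T$ over $Q$. Given $V\in\mathbf{rep}(Q)$ and bases $\mathcal B=\{\mathcal B_x\subseteq V_x\}_{x\in Q_0}$, the coefficient quiver $\Gamma(V;\mathcal B)$ has vertex set $\bigsqcup_{x\in Q_0}\mathcal B_x$, and an arrow from $b\in\mathcal B_x$ to $b'\in\mathcal B_{x'}$ for each arrow $\alpha:x\to x'$ of $Q$ such that the matrix of $V_\alpha$ in the bases $\mathcal B$ has a non-zero coefficient in column $b$ and row $b'$. A representation $V$ is a rooted tree module over $Q$ if there is a choice of bases $\mathcal B$ for which $\Gamma(V;\mathcal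 B)$ is a rooted tree quiver. *)

(* Defs.v *)
From HB Require Import structures.
From mathcomp Require Import freeg.
From mathcomp Require Import all_boot all_order all_algebra.
From mathcomp Require Import boolp classical_sets functions cardinality.
From mathcomp Require Import reals topology normedtype.

Set Implicit Arguments.
Unset Strict Implicit.
Unset Printing Implicit Defensive.

Import Order.TTheory GRing.Theory Num.Theory.
Import numFieldNormedType.Exports.

Local Open Scope classical_set_scope.
Local Open Scope ring_scope.

Section FinitelyGenerated.
Variables (k : fieldType) (V : lmodType k).

Definition finitely_generated :=
  exists n (s : 'I_n -> V), forall v, exists c : 'I_n -> k,
    v = \sum_(i < n) c i *: s i.

Lemma finitely_generatedI (J : finType) (s : J -> V) :
  (forall v, exists c : J -> k, v = \sum_j c j *: s j) -> finitely_generated.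
Proof.
move=> gen; exists #|J|, (fun i => s (enum_val i)) => v.
have [c ->] := gen v; exists (fun i => c (enum_val i)).
by rewrite (reindex (@enum_val _ predT)) //=; apply: onW_bij; apply: enum_val_bij.
Qed.

Lemma vector_axiom_of_fg : finitely_generated -> {n & Vector.axiom n V}.
Proof.
move=> fg.
pose P n := `[< exists s : 'I_n -> V, forall v, exists c : 'I_n -> k,
    v = \sum_(i < n) c i *: s i >].
have exP : exists n, P n by case: fg => n sP; exists n; apply/asboolP.
case: (ex_minnP exP) => m /asboolP /cid [s sP] m_min; exists m.
pose f (u : 'rV[k]_m) := \sum_i u 0 i *: s i.
have f_lin : linear f.
  move=> a u v; rewrite /f scaler_sumr -big_split; apply: eq_bigr => i _ /=.
  by rewrite !mxE scalerDl scalerA.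
pose fL : {linear 'rV[k]_m -> V} :=
  HB.pack f (GRing.isLinear.Build k _ _ _ f f_lin).
have f_inj : injective fL.
  apply: raddf_inj => u u0; apply: contrapT => /eqP /rV0Pn [j uj0].
  suff : (m <= m.-1)%N by rewrite leqNgt ltn_predL (leq_ltn_trans _ (ltn_ord j)).
  apply: m_min; apply/asboolP.
  exists (fun i => s (lift j i)) => v; have [c ->] := sP v.
  have sj : s j = \sum_(i < m.-1) (- (u 0 j)^-1 * u 0 (lift j i)) *: s (lift j i).
    have : f u = 0 := u0.
    rewrite /f (bigD1_ord j) //= => /eqP; rewrite addr_eq0 => /eqP /(congr1
      (fun x => (u 0 j)^-1 *: x)).
    rewrite scalerA mulVf // scale1r => ->; rewrite scalerN scaler_sumr -sumrN.
    by apply: eq_bigr => i _; rewrite scalerA mulNr scaleNr.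
  exists (fun i => c j * (- (u 0 j)^-1 * u 0 (lift j i)) + c (lift j i)).
  rewrite (bigD1_ord j) //= {1}sj scaler_sumr -big_split /=.
  by apply: eq_bigr => i _; rewrite scalerA -scalerDl.
have f_surj v : exists u, f u = v.
  have [c ->] := sP v; exists (\row_i c i).
  by apply: eq_bigr => i _; rewrite mxE.
pose g v := projT1 (cid (f_surj v)).
have gK : cancel g f by move=> v; exact: (projT2 (cid (f_surj v))).
have fK : cancel f g by move=> u; apply: f_inj; exact: gK.
exists g; last by exists f.
by move=> a u v; apply: f_inj; rewrite /= gK f_lin !gK.
Qed.

End FinitelyGenerated.

Section Dsum.
Variables (k : fieldType) (I : finType) (V : I -> vectType k).

(* Finite direct sums are realized as dependent products. *)
Definition dsum : Type := {dffun forall i, V i}.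
HB.instance Definition _ := Choice.on dsum.

Implicit Types u v w : dsum.

Let dadd u v : dsum := [ffun i => u i + v i].
Let dopp u : dsum := [ffun i => - u i].
Let dzero : dsum := [ffun i => 0].
Let dscale (c : k) u : dsum := [ffun i => c *: u i].

Fact daddA : associative dadd.
Proof. by move=> u v w; apply/ffunP=> i; rewrite !ffunE addrA. Qed.
Fact daddC : commutative dadd.
Proof. by move=> u v; apply/ffunP=> i; rewrite !ffunE addrC. Qed.
Fact dadd0 : left_id dzero dadd.
Proof. by move=> u; apply/ffunP=> i; rewrite !ffunE add0r. Qed.
Fact daddN : left_inverse dzero dopp dadd.
Proof. by move=> u; apply/ffunP=> i; rewrite !ffunE addNr. Qed.
HB.instance Definition _ := GRing.isZmodule.Build dsum daddA daddC dadd0 daddN.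

Fact dscaleA a b u : dscale a (dscale b u) = dscale (a * b) u.
Proof. by apply/ffunP=> i; rewrite !ffunE scalerA. Qed.
Fact dscale1 : left_id 1 dscale.
Proof. by move=> u; apply/ffunP=> i; rewrite !ffunE scale1r. Qed.
Fact dscaleDr : right_distributive dscale +%R.
Proof. by move=> a u v; apply/ffunP=> i; rewrite !ffunE scalerDr. Qed.
Fact dscaleDl u : {morph dscale^~ u : a b / a + b}.
Proof. by move=> a b; apply/ffunP=> i; rewrite !ffunE scalerDl. Qed.
HB.instance Definition _ := GRing.Zmodule_isLmodule.Build k dsum
  dscaleA dscale1 dscaleDr dscaleDl.

Lemma dsumP u v : (forall i, u i = v i) -> u = v.
Proof. by move=> uv; apply/ffunP. Qed.
Lemma dsumDE u v i : (u + v) i = u i + v i. Proof. exact: ffunE. Qed.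
Lemma dsumZE a u i : (a *: u) i = a *: u i. Proof. exact: ffunE. Qed.
Lemma dsum0E i : (0 : dsum) i = 0. Proof. exact: ffunE. Qed.
Lemma dsum_sumE (J : Type) (r : seq J) (P : pred J) (F : J -> dsum) i :
  (\sum_(j <- r | P j) F j) i = \sum_(j <- r | P j) F j i.
Proof. by apply: (big_morph (fun u : dsum => u i)) => [u v|]; rewrite ffunE. Qed.

Definition dsum_in i (x : V i) : dsum := [ffun j => dfwith (fun j => 0 : V j) x j].

Lemma dsum_in_linear i : linear (@dsum_in i).
Proof.
move=> a x y; apply/ffunP => j; rewrite dsumDE dsumZE !ffunE.
have [<-|ij] := eqVneq i j; first by rewrite !dfwith_in.
by rewrite !dfwith_out // scaler0 addr0.
Qed.
HB.instance Definition _ i := GRing.isLinear.Build k (V i) dsum _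
  (@dsum_in i) (@dsum_in_linear i).

Lemma dsum_in_sum u : u = \sum_i dsum_in (u i).
Proof.
apply/ffunP => j; rewrite dsum_sumE (bigD1 j) //= big1 ?addr0.
  by rewrite ffunE dfwith_in.
by move=> i ij; rewrite ffunE dfwith_out.
Qed.

Lemma dsum_fg : finitely_generated dsum.
Proof.
apply: (@finitely_generatedI _ _ {i : I & 'I_(\dim {:V i})}
  (fun p => dsum_in (vbasis {:V (tag p)})`_(tagged p))) => u.
exists (fun p => coord (vbasis {:V (tag p)}) (tagged p) (u (tag p))).
rewrite {1}[u]dsum_in_sum
  -(@sig_big_dep _ _ _ _ _ xpredT (fun _ _ => true)
     (fun i j => coord (vbasis {:V i}) j (u i) *: dsum_in (vbasis {:V i})`_j)).
apply: eq_bigr => i _; rewrite {1}(coord_vbasis (memvf (u i))) linear_sum.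
by apply: eq_bigr => j _; rewrite linearZ.
Qed.

HB.instance Definition _ := Lmodule_hasFinDim.Build k dsum
  (projT2 (vector_axiom_of_fg dsum_fg)).

End Dsum.

Record quiver := Quiver {
  vertex : finType;
  arrow : finType;
  src : arrow -> vertex;
  tgt : arrow -> vertex }.

Definition outdeg (Q : quiver) (x : vertex Q) := #|[set a : arrow Q | src a == x]|.

Section Tree.
Variable Q : quiver.

(* A step (a, b) traverses the arrow a, forwards if b and backwards otherwise. *)
Definition step : Type := arrow Q * bool.
Definition step_src (s : step) := if s.2 then src s.1 else tgt s.1.
Definition step_tgt (s : step) := if s.2 then tgt s.1 else src s.1.

(* Loops (length 1) and pairs of parallel or opposite arrows (length 2) are
   cycles: the arrows, not only the vertices, are required to be distinct. *)
Definition undirected_cycle (w : seq step) :=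
  [&& w != [::], cycle (fun s t => step_tgt s == step_src t) w,
      uniq [seq s.1 | s <- w] & uniq [seq step_src s | s <- w]].

Definition adjacent (x y : vertex Q) :=
  [exists a, ((src a == x) && (tgt a == y)) || ((src a == y) && (tgt a == x))].

Definition is_tree :=
  [/\ (0 < #|vertex Q|)%N, forall x y, connect adjacent x y
    & forall w, ~~ undirected_cycle w].

Definition is_rooted_tree (r : vertex Q) :=
  is_tree /\ forall x, outdeg x = 0%N <-> x = r.

End Tree.

Record rooted_tree_quiver := RootedTreeQuiver {
  rt_quiver :> quiver;
  rt_root : vertex rt_quiver;
  rt_rooted : is_rooted_tree rt_root }.

Record quiver_hom (Q' Q : quiver) := QuiverHom {
  qh0 : vertex Q' -> vertex Q;
  qh1 : arrow Q' -> arrow Q;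
  qh_src : forall a, qh0 (src a) = src (qh1 a);
  qh_tgt : forall a, qh0 (tgt a) = tgt (qh1 a) }.

Record rooted_tree_over (Q : rooted_tree_quiver) := RootedTreeOver {
  rto_tree :> rooted_tree_quiver;
  rto_hom : quiver_hom rto_tree Q;
  rto_root : qh0 rto_hom (rt_root rto_tree) = rt_root Q }.

Section Representations.
Variables (k : fieldType) (Q : quiver).

Record rep := Rep {
  rep_ob :> vertex Q -> vectType k;
  rep_map : forall a : arrow Q, 'Hom(rep_ob (src a), rep_ob (tgt a)) }.

Record rep_hom (V W : rep) := RepHom {
  rh_map :> forall x, 'Hom(V x, W x);
  rh_nat : forall a,
    (rh_map (tgt a) \o rep_map V a = rep_map W a \o rh_map (src a))%VF }.

Definition rep_iso (V W : rep) :=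
  exists (f : rep_hom V W) (g : rep_hom W V),
    forall x, (g x \o f x = \1)%VF /\ (f x \o g x = \1)%VF.

Section DirectSum.
Variables (I : finType) (V : I -> rep).

Definition rep_dsum_fun a (u : dsum (fun i => V i (src a))) :
  dsum (fun i => V i (tgt a)) := [ffun i => rep_map (V i) a (u i) : V i (tgt a)].

Lemma rep_dsum_linear a : linear (@rep_dsum_fun a).
Proof.
move=> c u v; apply: dsumP => i; rewrite dsumDE dsumZE !ffunE.
by rewrite linearP.
Qed.
HB.instance Definition _ a :=
  GRing.isLinear.Build k _ _ _ (@rep_dsum_fun a) (@rep_dsum_linear a).

Definition rep_dsum : rep :=
  @Rep (fun x => dsum (fun i => V i x)) (fun a => linfun (@rep_dsum_fun a)).

End DirectSum.

Definition finite_sum_of (P : rep -> Prop) (V : rep) :=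
  exists n (W : 'I_n -> rep), (forall i, P (W i)) /\ rep_iso V (rep_dsum W).

Definition direct_summand (W V : rep) :=
  exists W' : rep, rep_iso V (rep_dsum (fun b : bool => if b then W else W')).

Definition add_closure (P : rep -> Prop) : rep -> Prop :=
  finite_sum_of (fun W => exists2 V, P V & direct_summand W V).

Definition const_rep : rep := @Rep (fun=> k^o) (fun=> \1%VF).

End Representations.

Section PushForward.
Variables (k : fieldType) (Q' Q : quiver) (f : quiver_hom Q' Q) (V : rep k Q').

Definition fiber0 (x : vertex Q) : finType := {y : vertex Q' | qh0 f y == x}.
Definition fiber1 (a : arrow Q) : finType := {b : arrow Q' | qh1 f b == a}.

Fact fiber_src_subproof a (b : fiber1 a) : qh0 f (src (val b)) == src a.
Proof. by rewrite qh_src (eqP (valP b)). Qed.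
Fact fiber_tgt_subproof a (b : fiber1 a) : qh0 f (tgt (val b)) == tgt a.
Proof. by rewrite qh_tgt (eqP (valP b)). Qed.

Definition fiber_src a (b : fiber1 a) : fiber0 (src a) :=
  exist _ (src (val b)) (fiber_src_subproof b).
Definition fiber_tgt a (b : fiber1 a) : fiber0 (tgt a) :=
  exist _ (tgt (val b)) (fiber_tgt_subproof b).

Definition push_ob (x : vertex Q) : vectType k :=
  dsum (fun y : fiber0 x => V (val y)).

(* The sum over b of the maps V_b, each extended by zero to the other summands
   of the source and composed with the inclusion of its target summand. *)
Definition push_fun a (u : push_ob (src a)) : push_ob (tgt a) :=
  \sum_(b : fiber1 a)
    @dsum_in _ _ (fun y : fiber0 (tgt a) => V (val y)) (fiber_tgt b)
      (rep_map V (val b) (u (fiber_src b))).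

Lemma push_linear a : linear (@push_fun a).
Proof.
move=> c u v; rewrite /push_fun scaler_sumr -big_split.
by apply: eq_bigr => b _ /=; rewrite dsumDE dsumZE linearP linearP.
Qed.
HB.instance Definition _ a :=
  GRing.isLinear.Build k _ _ _ (@push_fun a) (@push_linear a).

Definition push_forward : rep k Q :=
  @Rep k Q push_ob (fun a => linfun (@push_fun a)).

End PushForward.

Definition linearization (k : fieldType) (Q : rooted_tree_quiver)
  (T : rooted_tree_over Q) : rep k Q :=
  push_forward (rto_hom T) (const_rep k T).

Definition linearized_rooted_tree (k : fieldType) (Q : rooted_tree_quiver)
  (V : rep k Q) := exists T : rooted_tree_over Q, rep_iso V (linearization k T).

Section CoefficientQuiver.
Variables (k : fieldType) (Q : quiver) (V : rep k Q).

Definition rep_bases := forall x : vertex Q, (\dim {:V x}).-tuple (V x).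

Variable B : rep_bases.

(* Basis vectors are represented by their positions in the bases; being free,
   the bases have no repetitions. *)
Definition coef_vertex : finType := {x : vertex Q & 'I_(\dim {:V x})}.

Definition coef_index : finType :=
  {a : arrow Q & ('I_(\dim {:V (src a)}) * 'I_(\dim {:V (tgt a)}))%type}.

(* The coefficient of V_a in column i and row j, for e = (a, (i, j)). *)
Definition coef (e : coef_index) : k :=
  coord (B (tgt (tag e))) (tagged e).2
    (rep_map V (tag e) (tnth (B (src (tag e))) (tagged e).1)).

Definition coefficient_quiver : quiver :=
  @Quiver coef_vertex {e : coef_index | coef e != 0}
    (fun e => Tagged (fun x => 'I_(\dim {:V x})) (tagged (val e)).1)
    (fun e => Tagged (fun x => 'I_(\dim {:V x})) (tagged (val e)).2).

End CoefficientQuiver.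

Definition rooted_tree_module (k : fieldType) (Q : quiver) (V : rep k Q) :=
  exists B : rep_bases V, (forall x, basis_of {:V x} (B x)) /\
    exists r, @is_rooted_tree (coefficient_quiver B) r.

Section PathCategory.
Variable Q : quiver.

Inductive qpath (x : vertex Q) : vertex Q -> Type :=
| qpath_id : qpath x x
| qpath_rcons (a : arrow Q) : qpath x (src a) -> qpath x (tgt a).

Definition qpath_arrow (a : arrow Q) : qpath (src a) (tgt a) :=
  qpath_rcons (qpath_id (src a)).

Fixpoint qpath_cat x y z (p : qpath x y) (q : qpath y z) : qpath x z :=
  match q with
  | qpath_id => p
  | qpath_rcons a q' => qpath_rcons (qpath_cat p q')
  end.

End PathCategory.

(* Simplices are functions on the whole real line, continuous on [0, 1]. Every
   continuous map on [0, 1] extends to such a function, and since boundaries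
   only involve the values at 0 and 1, the choice of the extension does not
   affect the image of the boundary map. *)
Record simplex1 (R : realType) (X : topologicalType) := Simplex1 {
  simplex1_fun :> R -> X;
  simplex1_cont : {within `[0, 1]%classic, continuous simplex1_fun} }.

HB.instance Definition _ R X := gen_eqMixin (simplex1 R X).
HB.instance Definition _ R X := gen_choiceMixin (simplex1 R X).

Definition path_component (R : realType) (X : topologicalType) (x : X) : set X :=
  [set y | exists g : simplex1 R X, g 0 = x /\ g 1 = y].

Record ftop (R : realType) := FTop {
  ftop_space :> topologicalType;
  ftop_fin : finite_set (range (@path_component R ftop_space)) }.

Record ftop_hom (R : realType) (X Y : ftop R) := FTopHom {
  ftop_hom_fun :> X -> Y;
  ftop_hom_cont : continuous ftop_hom_fun }.

Section FreeModule.
Variables (k : fieldType) (K : choiceType) (M : lmodType k) (f : K -> M).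

HB.instance Definition _ := GRing.isZmodMorphism.Build {freeg K / k} M
  (fglift f) (lift_is_additive f).

Lemma fglift_scalable : scalable (fglift f).
Proof.
move=> a u.
have -> : a *: u = \sum_(x <- dom u) << a * coeff x u *g x >> by [].
rewrite -[in RHS](freeg_sumE u) !raddf_sum.
apply: eq_bigr => x _.
by apply: etrans (liftU f _ _) _; rewrite -scalerA; congr (_ *: _); apply: esym; apply: liftU.
Qed.

HB.instance Definition _ := GRing.isScalable.Build k {freeg K / k} M *:%R
  (fglift f) fglift_scalable.

End FreeModule.

Section Cokernel.
Variables (k : pzRingType) (U V : lmodType k) (d : {linear U -> V}).
Local Open Scope quotient_scope.

Definition im_pred : {pred V} := fun v => `[< exists u, d u = v >].

Lemma im_zmod_closed : zmod_closed im_pred.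
Proof.
split; first by apply/asboolP; exists 0; rewrite linear0.
move=> x y /asboolP [u <-] /asboolP [v <-]; apply/asboolP.
by exists (u - v); rewrite linearB.
Qed.
HB.instance Definition _ := GRing.isZmodClosed.Build V im_pred im_zmod_closed.

Definition coker : Type := Quotient.quot im_pred.
HB.instance Definition _ := GRing.Zmodule.on coker.

Definition coker_pi (v : V) : coker := \pi_(Quotient.quot im_pred) v.

Lemma coker_piP (x y : V) :
  coker_pi x = coker_pi y <-> exists u, d u = x - y.
Proof.
split=> [/eqmodP|] /=.
  by move/asboolP.
by move=> h; apply/eqmodP/asboolP.
Qed.

Definition coker_repr (c : coker) : V := repr (c : Quotient.quot im_pred).
Lemma coker_reprK : cancel coker_repr coker_pi.
Proof. by move=> c; apply: reprK. Qed.

Let cscale (a : k) (c : coker) : coker := coker_pi (a *: coker_repr c).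

Fact coker_pi_zmod : zmod_morphism coker_pi.
Proof. exact: (raddfB (\pi_(Quotient.quot im_pred))). Qed.
HB.instance Definition _ :=
  GRing.isZmodMorphism.Build V coker coker_pi coker_pi_zmod.

Fact cscale_pi a v : cscale a (coker_pi v) = coker_pi (a *: v).
Proof.
apply/coker_piP; have /coker_piP [u du] := coker_reprK (coker_pi v).
by exists (a *: u); rewrite linearZ /= du scalerBr.
Qed.

Fact cscaleA a b c : cscale a (cscale b c) = cscale (a * b) c.
Proof. by rewrite -[c]coker_reprK !cscale_pi scalerA. Qed.
Fact cscale1 : left_id 1 cscale.
Proof. by move=> c; rewrite -[c]coker_reprK cscale_pi scale1r. Qed.
Fact cscaleDr : right_distributive cscale +%R.
Proof.
move=> a b c; rewrite -[b]coker_reprK -[c]coker_reprK.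
by rewrite -raddfD !cscale_pi scalerDr raddfD.
Qed.
Fact cscaleDl c : {morph cscale^~ c : a b / a + b}.
Proof.
by move=> a b; rewrite -[c]coker_reprK !cscale_pi scalerDl raddfD.
Qed.
HB.instance Definition _ := GRing.Zmodule_isLmodule.Build k coker
  cscaleA cscale1 cscaleDr cscaleDl.

Fact coker_pi_scalable : scalable coker_pi.
Proof. by move=> a v; apply: esym; apply: cscale_pi. Qed.
HB.instance Definition _ :=
  GRing.isScalable.Build k V coker *:%R coker_pi coker_pi_scalable.

End Cokernel.

Section H0.
Variables (k : fieldType) (R : realType).

Section Chains.
Variable X : topologicalType.

Definition bdry1 : {freeg (simplex1 R X) / k} -> {freeg X / k} :=
  fglift (fun g : simplex1 R X => << g 1 >> - << g 0 >>).
HB.instance Definition _ := GRing.Linear.on bdry1.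

End Chains.

(* Singular homology in degree 0: the boundary out of degree 0 is zero. *)
Definition H0 (X : ftop R) : Type := coker (@bdry1 X).
HB.instance Definition _ (X : ftop R) := GRing.Lmodule.on (H0 X).

Definition H0_pi (X : ftop R) : {freeg X / k} -> H0 X := @coker_pi _ _ _ (@bdry1 X).
HB.instance Definition _ (X : ftop R) := GRing.Linear.on (@H0_pi X).

Lemma H0_piP (X : ftop R) (c d : {freeg X / k}) :
  H0_pi c = H0_pi d <-> exists s, bdry1 s = c - d.
Proof. exact: coker_piP. Qed.

Lemma H0_path (X : ftop R) (x y : X) :
  path_component R x y -> H0_pi << x >> = H0_pi << y >>.
Proof.
case=> g [<- <-]; apply/esym/H0_piP; exists << g >>.
by rewrite /bdry1 liftU scale1r.
Qed.

Lemma path_component_refl (X : topologicalType) (x : X) : path_component R x x.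
Proof.
have cx : {within `[0, 1]%classic, continuous (fun _ : R => x)}.
  by apply: continuous_subspaceT => y; apply: cst_continuous.
by exists (Simplex1 cx).
Qed.

Lemma H0_fg (X : ftop R) : finitely_generated (H0 X).
Proof.
have /finite_seqP [s sE] := ftop_fin X; pose F := seq_sub s.
have rP (A : F) : exists x : X, path_component R x = val A.
  have : [set` s] (val A) by exact: valP.
  by rewrite -sE => -[x _ <-]; exists x.
pose r A := projT1 (cid (rP A)).
have rE A : path_component R (r A) = val A := projT2 (cid (rP A)).
apply: (@finitely_generatedI _ _ F (fun A => H0_pi << r A >>)) => v.
have gen1 (x : X) : exists A : F, H0_pi << x >> = H0_pi << r A >>.
  have : range (@path_component R X) (path_component R x) by exists x.
  rewrite sE => xs; exists (SeqSub xs); apply/esym/H0_path.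
  by rewrite rE /=; apply: path_component_refl.
pose a x := projT1 (cid (gen1 x)).
have aE x : H0_pi << x >> = H0_pi << r (a x) >> := projT2 (cid (gen1 x)).
pose c := coker_repr v; have <- : H0_pi c = v by apply: coker_reprK.
exists (fun A => \sum_(x <- dom c | a x == A) coeff x c).
rewrite -[LHS](congr1 (@H0_pi X) (freeg_sumE c)) raddf_sum.
under [RHS]eq_bigr do rewrite scaler_suml.
rewrite (exchange_big_dep xpredT) //=; apply: eq_bigr => x _.
rewrite (big_pred1 (a x)) => [|A]; last by rewrite /= eq_sym.
rewrite -aE -linearZ; congr (H0_pi _).
by apply/eqP/freeg_eqP => y; rewrite coeffZ !coeffU mul1r.
Qed.

HB.instance Definition _ (X : ftop R) := Lmodule_hasFinDim.Build k (H0 X)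
  (projT2 (vector_axiom_of_fg (@H0_fg X))).

Section Functoriality.
Variables (X Y : ftop R) (f : ftop_hom X Y).

Definition chain0_map : {freeg X / k} -> {freeg Y / k} :=
  fglift (fun x : X => << f x >>).
HB.instance Definition _ := GRing.Linear.on chain0_map.

(* The value of the induced map at a class, computed on a representative cycle;
   independence of the representative is H0_map_pi. *)
Definition H0_map_fun (c : H0 X) : H0 Y := H0_pi (chain0_map (coker_repr c)).

Lemma simplex1_comp_cont (g : simplex1 R X) :
  {within `[0, 1]%classic, continuous (f \o g)}.
Proof.
move=> x.
exact: (@continuous_comp _ X Y (from_subspace `[0, 1]%classic g) f x
          (@simplex1_cont R X g x) (@ftop_hom_cont R X Y f (g x))).
Qed.

Lemma chain0_map_bdry (s : {freeg (simplex1 R X) / k}) :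
  exists t, bdry1 t = chain0_map (bdry1 s).
Proof.
pose fg (g : simplex1 R X) := Simplex1 (@simplex1_comp_cont g).
exists (fglift (fun g => << fg g >>) s).
rewrite -(freeg_sumE s) !raddf_sum; apply: eq_bigr => g _ /=.
rewrite /bdry1 !liftU !linearZ /= liftU scale1r.
congr (_ *: _); rewrite /chain0_map raddfB /=.
by congr (_ - _); rewrite -[LHS]scale1r; apply: esym; apply: liftU.
Qed.

Lemma H0_map_pi (c : {freeg X / k}) :
  H0_map_fun (H0_pi c) = H0_pi (chain0_map c).
Proof.
apply/H0_piP; have /H0_piP [s ds] := coker_reprK (H0_pi c).
by have [t dt] := chain0_map_bdry s; exists t; rewrite dt ds linearB.
Qed.

Lemma H0_map_linear : linear H0_map_fun.
Proof.
move=> a u v; rewrite -[u]coker_reprK -[v]coker_reprK.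
move: (coker_repr u) (coker_repr v) => {u v} c d; rewrite -/(H0_pi c) -/(H0_pi d).
by rewrite -linearP !H0_map_pi !linearP.
Qed.
HB.instance Definition _ := GRing.isLinear.Build k (H0 X) (H0 Y) _
  H0_map_fun H0_map_linear.

Definition H0_map : 'Hom(H0 X, H0 Y) := linfun H0_map_fun.

End Functoriality.

End H0.

Record top_functor (R : realType) (Q : quiver) := TopFunctor {
  tf_ob :> vertex Q -> ftop R;
  tf_map : forall x y, qpath x y -> ftop_hom (tf_ob x) (tf_ob y);
  tf_id : forall x u, tf_map (qpath_id x) u = u;
  tf_cat : forall x y z (p : qpath x y) (q : qpath y z) u,
    tf_map (qpath_cat p q) u = tf_map q (tf_map p u) }.

Definition H0_rep (k : fieldType) (R : realType) (Q : quiver)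
    (F : top_functor R Q) : rep k Q :=
  @Rep k Q (fun x => H0 k (F x)) (fun a => H0_map k (tf_map F (qpath_arrow a))).

(* Objects of the essential image of H_0; a full subcategory is given by its
   predicate on objects. *)
Definition rep_H0 (R : realType) (k : fieldType) (Q : quiver) (V : rep k Q) :=
  exists F : top_functor R Q, rep_iso V (H0_rep k F).

(* Main.v *)
Require Import Defs.
From HB Require Import structures.
From mathcomp Require Import freeg.
From mathcomp Require Import all_boot all_order all_algebra.
From mathcomp Require Import boolp classical_sets cardinality.
From mathcomp Require Import reals topology normedtype.

Set Implicit Arguments.
Unset Strict Implicit.
Unset Printing Implicit Defensive.

(* Over a rooted tree quiver [Q] every vertex but the root has a unique outgoing
   arrow, so a functor from [Q] to finite sets is a forest over [Q] whose
   components are rooted trees over [Q]. A zeroth homology representation has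
   the path components as a basis, on which the arrows act by such a functor;
   this gives (1).

   For (2), consider forests whose trees may have their roots over any vertex,
   the arrow out of the root acting by zero. A representation [M] with a basis
   of this kind is a summand of a zeroth homology representation: add a base
   point over every vertex, to which the roots are mapped; reducing homology
   with respect to the base points gives back [M]. Conversely, if the branch of
   a forest at [s] maps to the branch at a sibling [s'] over [Q], subtracting
   from each basis vector of the first branch its image in the second one cuts
   the first branch off. Once no such pair of siblings is left, every
   endomorphism of a tree of the forest is triangular with constant diagonal
   for a suitable order, so endomorphism rings are local and the exchange
   argument of the Krull-Schmidt theorem shows that all summands are sums of
   trees. *)

Import Order.TTheory GRing.Theory Num.Theory.
Import numFieldNormedType.Exports.

Local Open Scope ring_scope.

(** * Rooted trees as quivers with unique outgoing arrows *)

Section Trees.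
Variable Q : quiver.
Implicit Types (a b c : arrow Q) (x y z : vertex Q) (s t : step Q).

Lemma outdegE x : outdeg x = #|[pred a : arrow Q | src a == x]|.
Proof. by apply: eq_card => a; apply/idP/idP => [/set_mem|/mem_set]. Qed.

(** Adjacency after deleting the arrow [a]. It is phrased with steps so that a path can be turned
    into the step lists of [undirected_cycle]. *)
Definition adjacent_off a : rel (vertex Q) := fun x y =>
  [exists s : step Q, [&& s.1 != a, step_src s == x & step_tgt s == y]].

Lemma adjacent_off_step a s :
  s.1 != a -> adjacent_off a (step_src s) (step_tgt s).
Proof. by move=> sa; apply/existsP; exists s; rewrite sa !eqxx. Qed.

Lemma adjacent_off_sym a : symmetric (adjacent_off a).
Proof.
suff sub x y : adjacent_off a x y -> adjacent_off a y x.
  by move=> x y; apply/idP/idP; apply: sub.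
case/existsP => -[c b] /and3P [/= ca /eqP <- /eqP <-].
apply/existsP; exists (c, ~~ b); rewrite /= ca.
by case: b; rewrite /step_src /step_tgt /= !eqxx.
Qed.

(** A simple path never reuses an arrow: [x] is an end of the first arrow, whereas both ends of
    every later arrow lie in [y :: p]. *)
Lemma steps_of_path a x p : path (adjacent_off a) x p -> uniq (x :: p) ->
  exists w : seq (step Q), [/\ map (@step_src Q) w = belast x p,
    map (@step_tgt Q) w = p, a \notin map fst w & uniq (map fst w)].
Proof.
elim: p x => [|y p IH] x /=; first by exists [::].
move=> /andP [/existsP [s /and3P [sa /eqP sx /eqP sy]] /IH{}IH].
rewrite inE negb_or => /and3P [/andP [xy xp] yp pu].
have [|w [w1 w2 w3 w4]] := IH; first by rewrite /= yp.
exists (s :: w); rewrite /= w1 w2 sx sy inE negb_or eq_sym sa w3; split=> //.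
rewrite w4 andbT; apply/negP => /mapP [t tw st].
have t1 : step_src t \in y :: p.
  by apply: mem_belast; rewrite -w1; apply: map_f.
have t2 : step_tgt t \in y :: p by rewrite inE -w2 map_f ?orbT.
have : x \in y :: p.
  move: sx t1 t2; rewrite /step_src /step_tgt -st.
  by case: (s.2) (t.2) => -[] -> // .
by rewrite inE (negPf xy) (negPf xp).
Qed.

Lemma cycle_of_steps s0 s (w : seq (step Q)) :
  map (@step_tgt Q) (s :: w) = map (@step_src Q) (rcons w s0) ->
  path (fun s t => step_tgt s == step_src t) s (rcons w s0).
Proof.
by elim: w s => [|t w IH] s /= [-> //] => [|e]; rewrite eqxx //= IH //= e.
Qed.

(** Each arrow is a bridge: a path from [tgt a] to [src a] avoiding [a], shortened to a simple one,
    would close up with [a] to a cycle. The empty path covers loops. *)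
Lemma acyclic_bridge a : (forall w, ~~ @undirected_cycle Q w) ->
  ~~ connect (adjacent_off a) (tgt a) (src a).
Proof.
move=> acyc; apply/negP => /connectP [p0 /shortenP [p pp pu _] e].
have [w [w1 w2 w3 w4]] := steps_of_path pp pu.
have /negP := acyc ((a, true) :: w); apply; rewrite /undirected_cycle /=.
apply/and3P; split.
- by apply: cycle_of_steps; rewrite map_rcons /= w1 w2 [step_src (a, true)]e -lastI.
- by rewrite w3.
have := pu; rewrite [tgt a :: p]lastI rcons_uniq w1 -e.
by case/andP=> -> ->.
Qed.

Variable r : vertex Q.

(** Climbing down in rank connects every vertex to [r]. On a cycle, take a vertex of maximal rank:
    the steps leaving and entering it both traverse arrows with that source, hence the same arrow,
    which a cycle cannot repeat. *)
Lemma rooted_treeP (rk : vertex Q -> nat) :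
  (forall a, (rk (tgt a) < rk (src a))%N) ->
  (forall x, x != r -> exists a, src a = x) ->
  (forall a, src a != r) ->
  (forall a b, src a = src b -> a = b) ->
  is_rooted_tree r.
Proof.
move=> rk_lt out_ex outr out_uniq; split; first split.
- by apply/card_gt0P; exists r.
- have adj_sym : connect_sym (@adjacent Q).
    by apply: sym_connect_sym => x y; apply: eq_existsb => a; rewrite orbC.
  have to_r x : connect (@adjacent Q) x r.
    have [n] := ubnP (rk x); elim: n x => // n IH x.
    have [-> //|/out_ex [a <-]] := eqVneq x r.
    move=> lt_n; apply: connect_trans (IH (tgt a) _).
      by apply: connect1; apply/existsP; exists a; rewrite !eqxx.
    by apply: leq_trans (rk_lt a) _.
  by move=> x y; apply: connect_trans (to_r x) _; rewrite adj_sym.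
- move=> w; apply/negP => /and4P [w_n w_c w_u w_v].
  have [s0 s0w s0max] : exists2 s0, s0 \in w &
      forall s, s \in w -> (rk (step_src s) <= rk (step_src s0))%N.
    case: w w_n {w_c w_u w_v} => // s w _.
    elim: w s => [|t w IH] s.
      by exists s; rewrite ?mem_head // => u; rewrite inE => /eqP ->.
    have [u uw umax] := IH t.
    have [le_su|/ltnW lt_us] := leqP (rk (step_src s)) (rk (step_src u)).
      exists u => [|v]; first by rewrite inE uw orbT.
      by rewrite inE => /predU1P [-> //|/umax].
    exists s => [|v]; first exact: mem_head.
    by rewrite inE => /predU1P [-> //|/umax /leq_trans->].
  have [i w' ew] := rot_to s0w.
  have {w_c} w_c : cycle (fun s t => step_tgt s == step_src t) (s0 :: w').
    by rewrite -ew rot_cycle.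
  have {w_u} w_u : uniq (map fst (s0 :: w')) by rewrite -ew map_rot rot_uniq.
  have {}s0max s : s \in s0 :: w' -> (rk (step_src s) <= rk (step_src s0))%N.
    by rewrite -ew mem_rot; apply: s0max.
  (* A backward step from the top vertex would end at a vertex of larger rank. *)
  have top s : s \in s0 :: w' -> step_src s = step_src s0 -> s.2.
    move=> sw ss; apply: contraT => /negPf s2.
    have ssE : tgt s.1 = step_src s0 by rewrite -ss /step_src s2.
    have := rk_lt s.1; rewrite ssE.
    have nx : next (s0 :: w') s \in s0 :: w' by rewrite mem_next.
    have : src s.1 = step_src (next (s0 :: w') s).
      have w_uu : uniq (s0 :: w') by apply: map_uniq w_u.
      by have /eqP <- := next_cycle w_c sw; rewrite /step_tgt s2.
    by move=> ->; rewrite ltnNge s0max.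
  have top0 := top s0 (mem_head _ _) erefl.
  case: (lastP w') => [|w'' s1] in w_c w_u s0max top.
    move: w_c; rewrite /= andbT /step_tgt /step_src top0 => /eqP e.
    by have := rk_lt s0.1; rewrite e ltnn.
  move: w_c; rewrite /= rcons_path last_rcons => /andP [_ /eqP e].
  have s1w : s1 \in rcons w'' s1 by rewrite mem_rcons mem_head.
  have s1f : ~~ s1.2.
    apply/negP => s12; have := rk_lt s1.1.
    move: e; rewrite /step_tgt s12 => ->.
    rewrite ltnNge => /negP; apply.
    by have := s0max s1; rewrite inE s1w orbT {1}/step_src s12; apply.
  move: e; rewrite /step_tgt /step_src (negPf s1f) top0 => /out_uniq e.
  by move: w_u; rewrite /= -e map_f.
move=> x; rewrite outdegE; split=> [/card0_eq x0|->].
  apply/eqP/contraT => /out_ex [a ax].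
  by have := x0 a; rewrite inE ax eqxx.
by apply: eq_card0 => a; rewrite inE (negPf (outr a)).
Qed.

Hypothesis rQ : is_rooted_tree r.

Let acyc w : ~~ @undirected_cycle Q w.
Proof. by case: rQ => -[]. Qed.

Lemma src_neq_root a : src a != r.
Proof.
apply/eqP => ar; have [_ /(_ r) [_ /(_ erefl)]] := rQ.
by rewrite outdegE => /card0_eq /(_ a); rewrite inE ar eqxx.
Qed.

Lemma out_arrow_exists x : x != r -> exists a, src a = x.
Proof.
move=> /eqP xr; have [_ /(_ x) [x0 _]] := rQ.
have /card_gt0P [a] : (0 < #|[pred a : arrow Q | src a == x]|)%N.
  by rewrite lt0n -outdegE; apply/eqP => /x0.
by rewrite inE => /eqP; exists a.
Qed.

Let out x := [pick a | src a == x].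
Let next_vertex x := oapp (@tgt Q) x (out x).

Let next_step x : x != r -> exists2 a, src a = x & next_vertex x = tgt a.
Proof.
move=> /out_arrow_exists [a ax]; rewrite /next_vertex /out.
by case: pickP => [b /eqP bx|/(_ a)]; [exists b | rewrite ax eqxx].
Qed.

(** By finiteness, an orbit missing [r] enters a directed cycle at some [z]. For the least period,
    the walk from [tgt a] back to [z = src a] does not use [a] again, contradicting
    [acyclic_bridge]. *)
Let reaches_root x : exists n, iter n next_vertex x == r.
Proof.
apply: contrapT => not_r; have {}not_r n : iter n next_vertex x != r.
  by apply/negP => nr; apply: not_r; exists n.
have /trajectP [i lt_i e] : iter (order next_vertex x) next_vertex x \in
    traject next_vertex x (order next_vertex x).
  exact: (loopingP (looping_order _ _)).
set z := iter i next_vertex x in e.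
have zP n : iter n next_vertex z != r by rewrite -iterD.
have /ex_minnP [k /eqP kz kmin] : exists k, iter k.+1 next_vertex z == z.
  exists (order next_vertex x - i).-1.
  rewrite prednK ?subn_gt0 // -[in X in X == _]iterD subnK 1?ltnW //.
  exact/eqP.
have [a az az'] := next_step (zP 0).
have /negP := acyclic_bridge a acyc; apply; rewrite az.
have conn j : (j <= k)%N ->
    connect (adjacent_off a) (tgt a) (iter j.+1 next_vertex z).
  elim: j => [|j IH] jk; first by rewrite /= az'.
  apply: connect_trans (IH (ltnW jk)) (connect1 _).
  have [b bz bz'] := next_step (zP j.+1).
  rewrite [iter j.+2 _ _]iterS bz' -bz.
  apply: (adjacent_off_step (s := (b, true))) => /=.
  apply/eqP => ba; have : (k <= j)%N by apply: kmin; rewrite -bz ba az.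
  by rewrite leqNgt jk.
by have := conn k (leqnn k); rewrite kz.
Qed.

(** Walk from [tgt a] and from [tgt b] until the root or [src a] is met. A walk ending at [src a]
    contradicts that [a], respectively [b], is a bridge; if both end at the root, they join [tgt a]
    to [tgt b], and [b] leads back to [src a] without [a]. *)
Lemma out_arrow_uniq a b : src a = src b -> a = b.
Proof.
move=> ab; apply/eqP/contraT => ab_n.
(* Adjacency along arrows not leaving [src a]: it avoids [a] and [b] simultaneously. *)
pose e : rel (vertex Q) := fun y z =>
  [exists s : step Q, [&& src s.1 != src a, step_src s == y & step_tgt s == z]].
have e_off c : src c = src a -> subrel (connect e) (connect (adjacent_off c)).
  move=> ca; apply: connect_sub => y z /existsP [s /and3P [sa /eqP <- /eqP <-]].
  apply/connect1/adjacent_off_step; apply: contraNneq sa => ->.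
  by rewrite ca.
have reach y : connect e y r \/ connect e y (src a).
  have [n] := reaches_root y; elim: n y => [y /= /eqP ->|n IH y]; first by left.
  rewrite iterSr => /IH yP.
  have [-> | yr] := eqVneq y r; first by left.
  have [-> | ya] := eqVneq y (src a); first by right.
  have [c cy cy'] := next_step yr.
  have yc : connect e y (next_vertex y).
    apply: connect1; apply/existsP; exists (c, true).
    by rewrite /step_src /step_tgt /= cy ya cy' !eqxx.
  by case: yP => yP; [left|right]; apply: connect_trans yP.
have /negP := acyclic_bridge a acyc; case.
have sym : connect_sym (adjacent_off a).
  exact/sym_connect_sym/adjacent_off_sym.
case: (reach (tgt a)) => [ar|]; last exact: e_off.
case: (reach (tgt b)) => [br|]; last first.
  move/(e_off b (esym ab)); rewrite ab.
  by rewrite (negPf (acyclic_bridge b acyc)).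
apply: connect_trans (e_off a erefl _ _ ar) _; rewrite sym.
rewrite ab; apply: connect_trans (e_off a erefl _ _ br).
apply/connect1/(@adjacent_off_step a (b, true)).
by rewrite /= eq_sym.
Qed.

(** The measure for all later inductions along parents in a forest. *)
Definition depth x := ex_minn (reaches_root x).

Lemma depth_src a : depth (src a) = (depth (tgt a)).+1.
Proof.
have step_a : next_vertex (src a) = tgt a.
  by have [b /out_arrow_uniq -> ->] := next_step (src_neq_root a).
rewrite /depth; case: ex_minnP => -[|n]; first by rewrite /= (negPf (src_neq_root a)).
rewrite iterSr step_a => nP nmin; case: ex_minnP => m mP mmin.
apply/eqP; rewrite eqSS eqn_leq mmin // andbT.
by rewrite -ltnS; apply: nmin; rewrite iterSr step_a.
Qed.

End Trees.

(** * Direct sums and the Krull-Schmidt exchange argument *)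

Lemma dependent_choice I (Y : I -> Type) (P : forall i, Y i -> Prop) :
  (forall i, exists y, P i y) -> exists f : forall i, Y i, forall i, P i (f i).
Proof.
move=> ex; exists (fun i => projT1 (cid (ex i))) => i.
exact: (projT2 (cid (ex i))).
Qed.

(** Linearity is taken as a plain hypothesis, so that functions defined inside proofs need no
    declared structure. *)
Lemma linfunE (k : fieldType) (U V : vectType k) (f : U -> V) :
  linear f -> forall u, linfun f u = f u.
Proof.
move=> f_lin u; pose fL : {linear U -> V} :=
  HB.pack f (GRing.isLinear.Build k U V _ f f_lin).
exact: (lfunE fL).
Qed.

Section RepHoms.
Variables (k : fieldType) (Q : quiver).
Implicit Types V W X : rep k Q.

Lemma rep_homE V W (f : rep_hom V W) a v :
  f (tgt a) (rep_map V a v) = rep_map W a (f (src a) v).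
Proof. by have /lfunP/(_ v) := rh_nat f a; rewrite !comp_lfunE. Qed.

Section HomOf.
Variables (V W : rep k Q) (f : forall x, V x -> W x).
Arguments f : clear implicits.
Hypothesis f_lin : forall x, linear (f x).
Hypothesis f_nat : forall a v,
  f (tgt a) (rep_map V a v) = rep_map W a (f (src a) v).

Fact hom_of_subproof a :
  (linfun (f (tgt a)) \o rep_map V a = rep_map W a \o linfun (f (src a)))%VF.
Proof.
apply/lfunP => v; rewrite !comp_lfunE (linfunE (@f_lin (src a))).
by rewrite (linfunE (@f_lin (tgt a))) f_nat.
Qed.

Definition hom_of := @RepHom k Q V W (fun x => linfun (f x)) hom_of_subproof.

Lemma hom_ofE x v : hom_of x v = f x v.
Proof. exact: linfunE. Qed.

End HomOf.

Lemma rep_hom_exists V W (f : forall x, V x -> W x) :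
  (forall x, linear (f x)) ->
  (forall a v, f (tgt a) (rep_map V a v) = rep_map W a (f (src a) v)) ->
  exists h : rep_hom V W, forall x v, h x v = f x v.
Proof. by move=> fl fn; exists (hom_of fl fn) => x v; apply: hom_ofE. Qed.

Definition hom_id V : rep_hom V V :=
  @hom_of V V (fun x v => v) (fun=> fun=> fun=> fun=> erefl) (fun=> fun=> erefl).

Lemma hom_idE V x v : hom_id V x v = v.
Proof. exact: hom_ofE. Qed.

Fact hom_comp_lin V W X (g : rep_hom W X) (f : rep_hom V W) x :
  linear (fun v => g x (f x v)).
Proof. by move=> c u v; rewrite !linearP. Qed.
Fact hom_comp_nat V W X (g : rep_hom W X) (f : rep_hom V W) a v :
  g (tgt a) (f (tgt a) (rep_map V a v)) = rep_map X a (g (src a) (f (src a) v)).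
Proof. by rewrite !rep_homE. Qed.
Definition hom_comp V W X (g : rep_hom W X) (f : rep_hom V W) : rep_hom V X :=
  hom_of (hom_comp_lin g f) (hom_comp_nat g f).

Lemma hom_compE V W X (g : rep_hom W X) (f : rep_hom V W) x v :
  hom_comp g f x v = g x (f x v).
Proof. exact: hom_ofE. Qed.

Fact hom_sub_lin V W (f g : rep_hom V W) x : linear (fun v => f x v - g x v).
Proof. by move=> c u v; rewrite !linearP scalerDr addrACA. Qed.
Fact hom_sub_nat V W (f g : rep_hom V W) a v :
  f (tgt a) (rep_map V a v) - g (tgt a) (rep_map V a v) =
  rep_map W a (f (src a) v - g (src a) v).
Proof. by rewrite !rep_homE linearB. Qed.
Definition hom_sub V W (f g : rep_hom V W) : rep_hom V W :=
  hom_of (hom_sub_lin f g) (hom_sub_nat f g).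

Lemma hom_subE V W (f g : rep_hom V W) x v : hom_sub f g x v = f x v - g x v.
Proof. exact: hom_ofE. Qed.

Definition mutual_inverse V W (f : rep_hom V W) (g : rep_hom W V) :=
  (forall x v, g x (f x v) = v) /\ (forall x w, f x (g x w) = w).

Lemma rep_isoP V W : rep_iso V W <-> exists f g, @mutual_inverse V W f g.
Proof.
split=> -[f [g fg]]; exists f, g.
  by split=> x v; have [] := fg x => /lfunP gf /lfunP fg';
    [have := gf v | have := fg' v]; rewrite comp_lfunE id_lfunE.
by case: fg => gf fg x; split; apply/lfunP => v; rewrite comp_lfunE id_lfunE.
Qed.

Lemma rep_iso_refl V : rep_iso V V.
Proof.
by apply/rep_isoP; exists (hom_id V), (hom_id V); split=> x v; rewrite !hom_idE.
Qed.

Lemma rep_iso_sym V W : rep_iso V W -> rep_iso W V.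
Proof. by move/rep_isoP=> [f [g [gf fg]]]; apply/rep_isoP; exists g, f. Qed.

Definition invertible V (f : rep_hom V V) := exists g, mutual_inverse f g.

(** By finite dimension each component is bijective, and the inverses of the components are again
    natural. *)
Lemma injective_invertible V (f : rep_hom V V) :
  (forall x v, f x v = 0 -> v = 0) -> invertible f.
Proof.
move=> f_inj; have f0 x : lker (f x) == 0%VS.
  by apply/lker0P/raddf_inj; apply: f_inj.
pose g x := (f x)^-1%VF.
have [|a v|h hE] := @rep_hom_exists V V g; first by move=> x; apply: linearP.
  have e := rep_homE f (g (src a) v).
  rewrite [f (src a) _](lker0_lfunVK (f0 _)) in e.
  by rewrite -e [LHS](lker0_lfunK (f0 _)).
by exists h; split=> x v; rewrite hE /g ?(lker0_lfunK (f0 _)) ?(lker0_lfunVK (f0 _)).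
Qed.

Definition local V := forall f : rep_hom V V,
  invertible f \/ invertible (hom_sub f (hom_id V)).

(** The image of [e] is a subrepresentation; [j] is its inclusion and [q] is [e] with restricted
    codomain. *)
Lemma split_idempotent V (e : rep_hom V V) :
  (forall x v, e x (e x v) = e x v) ->
  exists W (j : rep_hom W V) (q : rep_hom V W),
    (forall x w, q x (j x w) = w) /\ (forall x v, j x (q x v) = e x v).
Proof.
move=> ee; pose im x := limg (e x).
pose W : rep k Q := @Rep k Q (fun x => subvs_of (im x))
  (fun a => linfun (fun w => vsproj (im (tgt a)) (rep_map V a (vsval w)))).
have eK x v : v \in im x -> e x v = v.
  by case/memv_imgP => u _ ->; apply: ee.
have e_im x v : e x v \in im x by apply: memv_img; apply: memvf.
have mapW a (w : W (src a)) : vsval (rep_map W a w) = rep_map V a (vsval w).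
  have lin : linear (fun w : subvs_of (im (src a)) =>
      vsproj (im (tgt a)) (rep_map V a (vsval w))) by move=> c u v; rewrite !linearP.
  rewrite /= linfunE // vsprojK // -(eK _ _ (subvsP w)) -rep_homE.
  exact: e_im.
have [|a v|j jE] := @rep_hom_exists W V (fun x w => vsval w).
- by move=> x c u v; rewrite linearP.
- exact: mapW.
have [|a v|q qE] := @rep_hom_exists V W (fun x v => vsproj (im x) (e x v)).
- by move=> x c u v; rewrite !linearP.
- by apply: subvs_inj; rewrite mapW !vsprojK ?e_im // rep_homE.
exists W, j, q; split=> x v; rewrite jE qE; last by rewrite vsprojK ?e_im.
by rewrite eK ?vsvalK //; apply: subvsP.
Qed.

(** The biproduct identities, an element-free form of an isomorphism with [rep_dsum W]. *)
Definition sum_decomposition (I : finType) V (W : I -> rep k Q) :=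
  exists (i_ : forall j, rep_hom (W j) V) (p_ : forall j, rep_hom V (W j)),
  [/\ forall j x w, p_ j x (i_ j x w) = w,
      forall j j' x w, j != j' -> p_ j x (i_ j' x w) = 0
    & forall x v, \sum_j i_ j x (p_ j x v) = v].

Lemma sum_decompositionP (I : finType) V (W : I -> rep k Q) :
  sum_decomposition V W <-> rep_iso V (rep_dsum W).
Proof.
have mapE a (u : rep_dsum W (src a)) j :
    (rep_map (rep_dsum W) a u : dsum _) j = rep_map (W j) a (u j).
  by rewrite /= lfunE /= ffunE.
split=> [[i_ [p_ [pi pi0 ip]]]|/rep_isoP [f [g [gf fg]]]].
  have [||f fE] := @rep_hom_exists V (rep_dsum W)
      (fun x v => [ffun j => p_ j x v : W j x] : dsum _).
  - by move=> x c u v; apply: dsumP => j; rewrite dsumDE dsumZE !ffunE linearP.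
  - by move=> a v; apply: dsumP => j; rewrite mapE !ffunE rep_homE.
  have [||g gE] := @rep_hom_exists (rep_dsum W) V
      (fun x u => \sum_j i_ j x ((u : dsum _) j)).
  - move=> x c u v; rewrite scaler_sumr -big_split; apply: eq_bigr => j _ /=.
    by rewrite dsumDE dsumZE linearP.
  - move=> a u; rewrite linear_sum; apply: eq_bigr => j _.
    by rewrite mapE rep_homE.
  apply/rep_isoP; exists f, g; split=> x v; rewrite gE fE.
    by rewrite -[RHS]ip; apply: eq_bigr => j _; rewrite ffunE.
  apply: dsumP => j; rewrite ffunE linear_sum (bigD1 j) //= pi big1 ?addr0 //.
  by move=> j' jj'; rewrite pi0 // eq_sym.
have [i_ iE] : exists i_ : forall j, rep_hom (W j) V, forall j x w,
    i_ j x w = g x (@dsum_in _ _ (fun j => W j x) j w).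
  apply: (@dependent_choice _ (fun j => rep_hom (W j) V) (fun j h => forall x w,
    h x w = g x (@dsum_in _ _ (fun j => W j x) j w))) => j.
  apply: rep_hom_exists => [x c u v|a w]; first by rewrite !linearP.
  rewrite -rep_homE; congr (g _ _); apply: dsumP => j'; rewrite mapE !ffunE.
  case: (eqVneq j j') => [<-|ne]; first by rewrite !dfwith_in.
  by rewrite !dfwith_out // linear0.
have [p_ pE] : exists p_ : forall j, rep_hom V (W j), forall j x v,
    p_ j x v = (f x v : dsum _) j.
  apply: (@dependent_choice _ (fun j => rep_hom V (W j))
    (fun j h => forall x v, h x v = (f x v : dsum _) j)) => j.
  apply: rep_hom_exists => [x c u v|a v]; first by rewrite linearP dsumDE dsumZE.
  by rewrite rep_homE mapE.
exists i_, p_; split=> [j x w|j j' x w ne|x v].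
- by rewrite pE iE fg ffunE dfwith_in.
- by rewrite pE iE fg ffunE dfwith_out // eq_sym.
rewrite -[RHS]gf [f x v]dsum_in_sum linear_sum.
by apply: eq_bigr => j _; rewrite iE pE.
Qed.

(** Any finite index type is allowed, so that a sum of sums is indexed by a sigma type. *)
Definition sums_of (P : rep k Q -> Prop) V :=
  exists (I : finType) (W : I -> rep k Q),
    (forall j, P (W j)) /\ sum_decomposition V W.

Lemma finite_sum_ofP (P : rep k Q -> Prop) V : finite_sum_of P V <-> sums_of P V.
Proof.
split=> [[n [W [PW /sum_decompositionP VW]]]|[I [W [PW [i_ [p_ [pi pi0 ip]]]]]]].
  by exists 'I_n, W.
exists #|I|, (fun j => W (enum_val j)); split=> //.
apply/sum_decompositionP.
exists (fun j => i_ (enum_val j)), (fun j => p_ (enum_val j)); split=> //.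
  by move=> j j' x w jj'; apply: pi0; rewrite (inj_eq enum_val_inj).
move=> x v; rewrite -[RHS]ip [RHS](reindex (@enum_val _ predT)) //=.
by apply: onW_bij; apply: enum_val_bij.
Qed.

Lemma sums_of_sub (P P' : rep k Q -> Prop) V :
  (forall W, P W -> P' W) -> sums_of P V -> sums_of P' V.
Proof. by move=> PP' [I [W [PW VW]]]; exists I, W; split=> // j; apply/PP'. Qed.

Lemma sums_of_sums (P : rep k Q -> Prop) V : sums_of (sums_of P) V -> sums_of P V.
Proof.
move=> [I [W [/choice [J /dependent_choice [U PU]] [i_ [p_ [pi pi0 ip]]]]]].
have [iU /dependent_choice [pU UP]] := dependent_choice (fun j => (PU j).2).
exists {j : I & J j}, (fun l => U (tag l) (tagged l)).
split; first by move=> [j l]; apply: (PU j).1.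
exists (fun l => hom_comp (i_ (tag l)) (iU (tag l) (tagged l))).
exists (fun l => hom_comp (pU (tag l) (tagged l)) (p_ (tag l))).
split=> [[j l] x w|[j l] [j' l'] x w|x v].
- by rewrite !hom_compE /= pi; have [-> _ _] := UP j.
- rewrite !hom_compE /=; have [jj'|ne] := eqVneq j j'; last first.
    by move=> _; rewrite pi0 // linear0.
  case: j' / jj' l' w => l' w; rewrite pi eq_Tagged /=.
  by have [_ U0 _] := UP j; apply: U0.
rewrite -[RHS]ip.
under eq_bigr do rewrite !hom_compE.
rewrite -(@sig_big_dep _ _ _ _ _ xpredT (fun _ _ => true)
  (fun j l => i_ j x (iU j l x (pU j l x (p_ j x v))))) /=.
by apply: eq_bigr => j _; rewrite -linear_sum; have [_ _ ->] := UP j.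
Qed.

Lemma sums_of_cons (P : rep k Q -> Prop) V X Y
    (i1 : rep_hom X V) (p1 : rep_hom V X) (i2 : rep_hom Y V) (p2 : rep_hom V Y) :
  P X -> sums_of P Y ->
  (forall x w, p1 x (i1 x w) = w) -> (forall x w, p2 x (i2 x w) = w) ->
  (forall x w, p1 x (i2 x w) = 0) -> (forall x w, p2 x (i1 x w) = 0) ->
  (forall x v, i1 x (p1 x v) + i2 x (p2 x v) = v) -> sums_of P V.
Proof.
move=> PX PY pi1 pi2 p1i2 p2i1 ip; apply: sums_of_sums.
exists bool, (fun b => if b then X else Y); split.
  case=> //; exists unit, (fun=> X); split=> //.
  exists (fun=> hom_id X), (fun=> hom_id X).
  split=> [j x w|[] []|x v]; rewrite ?hom_idE //.
  by rewrite big_const card_unit /= addr0.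
exists (fun b => match b return rep_hom (if b then X else Y) V with
  true => i1 | false => i2 end).
exists (fun b => match b return rep_hom V (if b then X else Y) with
  true => p1 | false => p2 end).
by split=> [[]|[] []|x v] //; rewrite -[RHS]ip big_bool.
Qed.

(* The exchange property of objects with local endomorphism rings: for
   [a := i_X p_X], either [a] or [a - 1] is invertible. In the first case [X]
   splits off from [W]; in the second case [X] is not needed for [W]. *)
Lemma krull_schmidt (P : rep k Q -> Prop) n (X : 'I_n -> rep k Q) :
  (forall V, P V -> local V) -> (forall j, P (X j)) ->
  forall W (i_ : forall j, rep_hom W (X j)) (p_ : forall j, rep_hom (X j) W),
  (forall x w, \sum_j p_ j x (i_ j x w) = w) -> sums_of P W.
Proof.
move=> Ploc; elim: n X => [|n IH] X PX W i_ p_ piE.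
  exists void, (of_void _); split; first by case.
  have W0 x (w : W x) : w = 0 by rewrite -(piE x w) big_ord0.
  exists (fun j : void => match j with end), (fun j : void => match j with end).
  by split=> [[]|[]|x v] //; rewrite [RHS]W0 big1 // => -[].
pose i0 := i_ ord0; pose p0 := p_ ord0.
pose rest x w := \sum_(j < n) p_ (lift ord0 j) x (i_ (lift ord0 j) x w).
have restE x w : rest x w = w - p0 x (i0 x w).
  by apply/eqP; rewrite eq_sym subr_eq addrC -{1}[w]piE big_ord_recl.
case: (Ploc _ (PX ord0) (hom_comp i0 p0)) => -[b [ba ab]].
  have {}ba x u : b x (i0 x (p0 x u)) = u by rewrite -[RHS]ba hom_compE.
  have {}ab x u : i0 x (p0 x (b x u)) = u by rewrite -[RHS]ab hom_compE.
  (* The idempotent projecting onto the kernel of [i0] along the image of [p0]. On its image [W1]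
     the map [rest] is the identity, so [W1] is a retract of the sum of the remaining [X]. *)
  pose e := hom_sub (hom_id W) (hom_comp p0 (hom_comp b i0)).
  have eE x w : e x w = w - p0 x (b x (i0 x w)).
    by rewrite hom_subE hom_idE !hom_compE.
  have i0e x w : i0 x (e x w) = 0 by rewrite eE linearB /= ab subrr.
  have ep0 x u : e x (p0 x u) = 0 by rewrite eE ba subrr.
  have [|W1 [j [q [qj jq]]]] := @split_idempotent W e.
    by move=> x w; rewrite [LHS]eE i0e !linear0 addr0.
  have i0j x u : i0 x (j x u) = 0 by rewrite -[u]qj jq i0e.
  have qp0 x u : q x (p0 x u) = 0.
    by rewrite -[LHS]qj jq ep0 linear0.
  have PW1 : sums_of P W1.
    apply: (IH _ (fun l => PX (lift ord0 l)) _
      (fun l => hom_comp (i_ (lift ord0 l)) j)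
      (fun l => hom_comp q (p_ (lift ord0 l)))) => x w.
    under eq_bigr do rewrite !hom_compE.
    by rewrite -linear_sum -/(rest _ _) restE i0j linear0 subr0 /= qj.
  apply: (sums_of_cons (PX ord0) PW1 (i1 := p0) (p1 := hom_comp b i0)
    (i2 := j) (p2 := q)) => // x w; rewrite ?hom_compE ?ba ?i0j ?linear0 //.
  by rewrite jq eE addrC subrK.
have {}ba x u : b x (i0 x (p0 x u) - u) = u.
  by rewrite -[RHS]ba hom_subE hom_idE hom_compE.
(* As [b] inverts [i0 p0 - 1], this is a left inverse of [rest = 1 - p0 i0], and [W] is already a
   retract of the sum of the remaining [X]. *)
pose h := hom_sub (hom_id W) (hom_comp p0 (hom_comp b i0)).
apply: (IH _ (fun l => PX (lift ord0 l)) _ (fun l => i_ (lift ord0 l))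
  (fun l => hom_comp h (p_ (lift ord0 l)))) => x w.
under eq_bigr do rewrite hom_compE.
rewrite -linear_sum -/(rest _ _) restE [LHS]hom_subE hom_idE !hom_compE.
have -> : i0 x (w - p0 x (i0 x w)) = - (i0 x (p0 x (i0 x w)) - i0 x w).
  by rewrite linearB opprB.
by rewrite 2!raddfN /= ba opprK subrK.
Qed.

End RepHoms.

(** * Forests over a rooted tree quiver and adapted bases *)

Record forest (Q : quiver) := Forest {
  node :> finType;
  pos : node -> vertex Q;
  par : node -> option node;
  par_arrow : forall s t, par s = Some t ->
    exists a, pos s = src a /\ pos t = tgt a }.

Arguments pos {Q f} s.
Arguments par {Q f} s.
Arguments par_arrow {Q f s t}.

(* The representation [V] has a basis [fb x s], indexed by the nodes [s] over
   [x], along which its arrows act as the parent map. The vectors [fb x s] are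
   defined for all [x], and vanish unless [s] lies over [x]; this avoids
   transporting along equalities of vertices. *)
Record framing (k : fieldType) (Q : quiver) (V : rep k Q) (S : forest Q) :=
  Framing {
  fb : forall x, S -> V x;
  fc : forall x, S -> V x -> k;
  fc_scalar : forall x s, scalar (fc (x := x) s);
  fb_off : forall x s, pos s != x -> fb x s = 0;
  fc_fb : forall x s t, pos t = x -> fc s (fb x t) = (s == t)%:R;
  fb_sum : forall x (v : V x), \sum_s fc s v *: fb x s = v;
  fb_map : forall a s, pos s = src a ->
    rep_map V a (fb (src a) s) = oapp (fb (tgt a)) 0 (par s) }.

HB.instance Definition _ k Q V S (F : @framing k Q V S) x s :=
  GRing.isLinear.Build k (V x) k _ (@fc _ _ _ _ F x s) (@fc_scalar _ _ _ _ F x s).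

Definition framed k Q (V : rep k Q) S := inhabited (framing V S).

Section Framings.
Variables (k : fieldType) (Q : rooted_tree_quiver).
Implicit Types (V W : rep k Q) (S T : forest Q).

Lemma pos_par S (s t : S) a : pos s = src a -> par s = Some t -> pos t = tgt a.
Proof.
by move=> sa /par_arrow [b []]; rewrite sa => /(out_arrow_uniq (rt_rooted Q)) ->.
Qed.

Lemma fc_off V S (F : framing V S) x (s : S) (v : V x) :
  pos s != x -> fc F s v = 0.
Proof.
move=> sx; rewrite -(fb_sum F v) linear_sum big1 // => t _ /=.
have [tx|tx] := eqVneq (pos t) x; last by rewrite fb_off // scaler0 linear0.
rewrite linearZ /= fc_fb //; case: eqVneq => [e|_]; last by rewrite mulr0.
by rewrite e tx eqxx in sx.
Qed.

Lemma framing_eq V S (F : framing V S) x (u v : V x) :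
  (forall s, pos s = x -> fc F s u = fc F s v) -> u = v.
Proof.
move=> uv; rewrite -(fb_sum F u) -(fb_sum F v); apply: eq_bigr => s _.
have [/uv -> //|sx] := eqVneq (pos s) x.
by rewrite !fc_off.
Qed.

Lemma fc_sum_fb V S (F : framing V S) x (c : S -> k) s : pos s = x ->
  fc F s (\sum_t c t *: fb F x t) = c s.
Proof.
move=> sx; rewrite linear_sum (bigD1 s) //= linearZ /= fc_fb // eqxx mulr1.
rewrite big1 ?addr0 // => t ts; rewrite linearZ /=.
have [tx|tx] := eqVneq (pos t) x; last by rewrite fb_off // linear0 mulr0.
by rewrite fc_fb // eq_sym (negPf ts) mulr0.
Qed.

Lemma framing_linear_eq V S (F : framing V S) x (U : lmodType k) (f g : V x -> U) :
  linear f -> linear g ->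
  (forall s, pos s = x -> f (fb F x s) = g (fb F x s)) -> f =1 g.
Proof.
move=> f_lin g_lin fg v.
pose fL : {linear V x -> U} := HB.pack f (GRing.isLinear.Build k _ _ _ f f_lin).
pose gL : {linear V x -> U} := HB.pack g (GRing.isLinear.Build k _ _ _ g g_lin).
rewrite -[f v]/(fL v) -[g v]/(gL v) -(fb_sum F v) !linear_sum.
apply: eq_bigr => s _; have [sx|sx] := eqVneq (pos s) x.
  by rewrite !linearZ /= fg.
by rewrite fb_off // scaler0 !linear0.
Qed.

Lemma framing_nat V W S (F : framing V S) (f : forall x, V x -> W x) :
  (forall x, linear (f x)) ->
  (forall a s, pos s = src a -> f (tgt a) (oapp (fb F (tgt a)) 0 (par s)) =
     rep_map W a (f (src a) (fb F (src a) s))) ->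
  forall a v, f (tgt a) (rep_map V a v) = rep_map W a (f (src a) v).
Proof.
move=> f_lin fP a v; move: v; apply: (framing_linear_eq (F := F)).
- by move=> c u v; rewrite linearP f_lin.
- by move=> c u v; rewrite f_lin linearP.
by move=> s sa; rewrite fb_map // fP.
Qed.

(** Basis vectors with the same node are matched; the arrows move both families by the same parent
    map. *)
Lemma framing_iso V W S : framing V S -> framing W S -> rep_iso V W.
Proof.
suff homs V' W' (F : framing V' S) (G : framing W' S) :
    exists h : rep_hom V' W', forall x v, h x v = \sum_s fc F s v *: fb G x s.
  move=> F G; have [f fE] := homs _ _ F G; have [g gE] := homs _ _ G F.
  apply/rep_isoP; exists f, g; split=> x v.
    rewrite gE fE -[RHS](fb_sum F); apply: eq_bigr => s _.
    have [sx|sx] := eqVneq (pos s) x; first by rewrite fc_sum_fb.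
    by rewrite fb_off // !scaler0.
  rewrite fE gE -[RHS](fb_sum G); apply: eq_bigr => s _.
  have [sx|sx] := eqVneq (pos s) x; first by rewrite fc_sum_fb.
  by rewrite fb_off // !scaler0.
have f_lin x : linear (fun v : V' x => \sum_s fc F s v *: fb G x s).
  move=> c u v; rewrite scaler_sumr -big_split; apply: eq_bigr => s _ /=.
  by rewrite linearP scalerDl scalerA.
have fbE x s : pos s = x -> \sum_t fc F t (fb F x s) *: fb G x t = fb G x s.
  move=> sx; rewrite (bigD1 s) //= fc_fb // eqxx scale1r big1 ?addr0 // => t ts.
  by rewrite fc_fb // (negPf ts) scale0r.
apply: rep_hom_exists => //.
apply: (framing_nat (F := F) (f := fun x v => \sum_s fc F s v *: fb G x s)) => //.
move=> a s sa.
rewrite fbE // fb_map //; case es: (par s) => [t|] /=.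
  by rewrite fbE // (pos_par sa es).
by rewrite big1 // => t _; rewrite linear0 scale0r.
Qed.

Lemma framing_transport V W S : rep_iso V W -> framing V S -> framed W S.
Proof.
move=> /rep_isoP [f [g [gf fg]]] F.
split; exists (fun x s => f x (fb F x s)) (fun x s w => fc F s (g x w)).
- by move=> x s c u v; rewrite !linearP.
- by move=> x s sx; rewrite fb_off // linear0.
- by move=> x s t tx; rewrite gf fc_fb.
- move=> x w; rewrite -[RHS]fg -[in RHS](fb_sum F (g x w)) linear_sum.
  by apply: eq_bigr => s _; rewrite linearZ.
move=> a s sa; rewrite -rep_homE fb_map //.
by case: (par s) => //=; rewrite linear0.
Qed.

Section Sum.
Variables (I : finType) (S : I -> forest Q).

Fact forest_sum_subproof (s t : {i : I & S i}) :
  omap (Tagged (fun i => S i)) (par (tagged s)) = Some t ->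
  exists a, pos (tagged s) = src a /\ pos (tagged t) = tgt a.
Proof. by case e: (par (tagged s)) => [u|] //= [<-]; apply: par_arrow e. Qed.

Definition forest_sum : forest Q := Forest forest_sum_subproof.

Lemma framing_sum V (W : I -> rep k Q) : sum_decomposition V W ->
  (forall i, framed (W i) (S i)) -> framed V forest_sum.
Proof.
move=> [i_ [p_ [pi pi0 ip]]] FW.
pose F i : framing (W i) (S i) := inhabited_witness (FW i).
split; exists (fun x (s : forest_sum) => i_ (tag s) x (fb (F (tag s)) x (tagged s)))
  (fun x (s : forest_sum) v => fc (F (tag s)) (tagged s) (p_ (tag s) x v)).
- by move=> x s c u v; rewrite !linearP.
- by move=> x s sx; rewrite fb_off // linear0.
- move=> x [i s] [j t] /= tx; have [ij|ne] := eqVneq i j; last first.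
    by rewrite pi0 // linear0 -tag_eqE /tag_eq /= (negPf ne).
  by case: j / ij t tx => t tx; rewrite pi fc_fb // eq_Tagged.
- move=> x v; rewrite -[RHS]ip.
  rewrite -(@sig_big_dep _ _ _ _ _ xpredT (fun _ _ => true) (fun i s =>
    fc (F i) s (p_ i x v) *: i_ i x (fb (F i) x s))) /=.
  apply: eq_bigr => i _; rewrite -[in RHS](fb_sum (F i) (p_ i x v)) linear_sum.
  by apply: eq_bigr => s _; rewrite linearZ.
move=> a [i s] /= sa; rewrite -rep_homE fb_map //.
by case: (par s) => //=; rewrite linear0.
Qed.

End Sum.

Section Components.
Variables (S : forest Q) (I : finType) (kappa : S -> I).
Hypothesis kappa_par : forall s t, par s = Some t -> kappa s = kappa t.

(** By [kappa_par] a parent stays in the fiber, so [insub] never discards one; see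
    [fiber_par_none]. *)
Definition fiber_par i (s : {s : S | kappa s == i}) : option {s : S | kappa s == i} :=
  obind insub (par (val s)).

Lemma fiber_parE i (s t : {s : S | kappa s == i}) :
  fiber_par s = Some t <-> par (val s) = Some (val t).
Proof.
rewrite /fiber_par; case e: (par (val s)) => [u|] //=; split=> [|[->]].
  by case: insubP => // v _ <- [->].
by rewrite valK.
Qed.

Lemma fiber_par_none i (s : {s : S | kappa s == i}) :
  fiber_par s = None <-> par (val s) = None.
Proof.
rewrite /fiber_par; case e: (par (val s)) => [u|] //=; split=> //.
by rewrite insubT // -(kappa_par e) (valP s).
Qed.

Fact fiber_forest_subproof i (s t : {s : S | kappa s == i}) :
  fiber_par s = Some t -> exists a, pos (val s) = src a /\ pos (val t) = tgt a.
Proof. by move/fiber_parE; apply: par_arrow. Qed.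

Definition fiber_forest i : forest Q := Forest (@fiber_forest_subproof i).

(** The projections [e_ i] onto the span of the basis vectors labelled [i] are orthogonal
    idempotents with sum 1. They commute with the arrows because [kappa] is constant along parents,
    and their images are the summands. *)
Lemma framing_fibers V : framing V S ->
  exists W : I -> rep k Q,
    (forall i, framed (W i) (fiber_forest i)) /\ sum_decomposition V W.
Proof.
move=> F.
pose e_ i x (v : V x) := \sum_(s | kappa s == i) fc F s v *: fb F x s.
have e_lin i x : linear (@e_ i x).
  move=> c u v; rewrite /e_ scaler_sumr -big_split; apply: eq_bigr => s _ /=.
  by rewrite linearP scalerDl scalerA.
have fc_e i x v s : fc F s (e_ i x v) = if kappa s == i then fc F s v else 0.
  have [sx|sx] := eqVneq (pos s) x; last by rewrite !(fc_off F _ sx) if_same.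
  rewrite -(fc_sum_fb F (fun s => if kappa s == i then fc F s v else 0) sx).
  congr (fc F s _); rewrite /e_ big_mkcond; apply: eq_bigr => t _.
  by case: ifP; rewrite ?scale0r.
have e_fb i x s : e_ i x (fb F x s) = if kappa s == i then fb F x s else 0.
  have [sx|sx] := eqVneq (pos s) x; last first.
    rewrite fb_off // if_same /e_ big1 // => t _.
    by rewrite linear0 scale0r.
  apply: (framing_eq (F := F)) => t tx; rewrite fc_e fc_fb //.
  case: ifP => ti; case: ifP => si; rewrite ?fc_fb ?linear0 //.
    by case: eqVneq => // ts; rewrite -ts ti in si.
  by case: eqVneq => // ts; rewrite ts si in ti.
have e_hom i : exists h : rep_hom V V, forall x v, h x v = e_ i x v.
  apply: rep_hom_exists; first exact: e_lin.
  apply: (framing_nat (F := F)) => // a s sa; rewrite e_fb [in RHS]fun_if.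
  rewrite linear0 fb_map //; case es: (par s) => [t|] /=.
    by rewrite e_fb (kappa_par es).
  by rewrite if_same /e_ big1 // => t _; rewrite linear0 scale0r.
have [h hE] := choice e_hom.
have h_idem i x v : h i x (h i x v) = h i x v.
  rewrite !hE; apply: (framing_eq (F := F)) => s sx; rewrite !fc_e.
  by case: (kappa s == i).
have [W WP] := choice (fun i => split_idempotent (h_idem i)).
have [j_ /dependent_choice [q_ jqP]] := dependent_choice WP.
have qj i x w : q_ i x (j_ i x w) = w by have [->] := jqP i.
have jq i x v : j_ i x (q_ i x v) = e_ i x v by have [_ ->] := jqP i; rewrite hE.
exists W; split=> [i|]; last first.
  exists j_, q_; split=> // [i i' x w ne|x v].
    rewrite -[w]qj -[LHS]qj jq jq; set v := j_ _ _ _.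
    have -> : e_ i x (e_ i' x v) = 0; last by rewrite linear0.
    apply: (framing_eq (F := F)) => s sx; rewrite !fc_e linear0.
    by case: eqP => // ->; rewrite (negPf ne).
  rewrite -[RHS](fb_sum F) (partition_big kappa xpredT) //=.
  by apply: eq_bigr => i _; rewrite jq.
have jqb x s : kappa s == i -> j_ i x (q_ i x (fb F x s)) = fb F x s.
  by move=> si; rewrite jq e_fb si.
split; exists (fun x (s : fiber_forest i) => q_ i x (fb F x (val s)))
  (fun x (s : fiber_forest i) w => fc F (val s) (j_ i x w)).
- by move=> x s c u v; rewrite !linearP.
- by move=> x s sx; rewrite fb_off // linear0.
- by move=> x s t tx; rewrite jqb ?(valP t) // fc_fb.
- move=> x w; transitivity (q_ i x (e_ i x (j_ i x w))); last by rewrite -jq !qj.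
  rewrite /e_ linear_sum.
  rewrite (reindex_omap (val : {s : S | kappa s == i} -> S) insub) /=.
    by apply: eq_big => [s|s _]; rewrite ?valK ?eqxx ?(valP s) ?linearZ.
  by move=> s si; rewrite insubT.
move=> a s sa; rewrite -rep_homE fb_map //.
have -> : par s = obind insub (par (val s)) by [].
case es: (par (val s)) => [t|] /=; last by rewrite linear0.
by rewrite insubT // -(kappa_par es) (valP s).
Qed.

End Components.

End Framings.

(** * Cutting branches *)

Section Reduction.
Variables (k : fieldType) (Q : rooted_tree_quiver).
Implicit Types (V W : rep k Q) (S : forest Q).

Definition node_depth S (s : S) := depth (rt_rooted Q) (pos s).

Lemma node_depth_par S (s t : S) :
  par s = Some t -> node_depth s = (node_depth t).+1.
Proof. by move=> /par_arrow [a [sa ta]]; rewrite /node_depth sa ta depth_src. Qed.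

(** A relation in place of a map of branches makes composition immediate; children are chosen only
    in [branch_map]. *)
Definition simulation S (r : S -> S -> Prop) := forall u v, r u v ->
  pos u = pos v /\
  forall u', par u' = Some u -> exists2 v', par v' = Some v & r u' v'.

(* [sim s t] holds if and only if the branch at [s] maps to the branch at [t]
   by a morphism over [Q] sending [s] to [t]. *)
Definition sim S (s t : S) := exists2 r, simulation r & r s t.

Lemma sim_refl S (s : S) : sim s s.
Proof. by exists eq => // u _ <-; split=> // u' uu'; exists u'. Qed.

Lemma sim_trans S (s t u : S) : sim s t -> sim t u -> sim s u.
Proof.
move=> [r rP st] [r' rP' tu]; exists (fun x z => exists2 y, r x y & r' y z).
  move=> x z [y /rP [-> xy] /rP' [-> yz]]; split=> // x' /xy [y' /yz [z' z'z y'z'] x'y'].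
  by exists z' => //; exists y'.
by exists t.
Qed.

(** No cut is possible any more. Roots of different trees do not count as siblings. *)
Definition reduced S := forall (s t u : S),
  s != t -> par s = Some u -> par t = Some u -> ~ sim s t.

Section Cut.
Variables (S : forest Q) (s0 s1 u0 : S).
Hypotheses (s01 : s0 != s1) (par0 : par s0 = Some u0) (par1 : par s1 = Some u0).

Definition cut_par (s : S) := if s == s0 then None else par s.

Fact cut_par_arrow s t : cut_par s = Some t ->
  exists a, pos s = src a /\ pos t = tgt a.
Proof. by rewrite /cut_par; case: eqP => // _; apply: par_arrow. Qed.

Definition cut_forest : forest Q := Forest cut_par_arrow.

(** Choosing simulated children from [s0] downwards gives a partial map defined on the branch at
    [s0]. Its values lie in the disjoint branch at [s1], whence the last clause: [h] cannot be
    applied twice. *)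
Lemma branch_map : sim s0 s1 -> exists h : S -> option S,
  [/\ h s0 = Some s1, forall s t, h s = Some t -> pos s = pos t,
      forall s, s != s0 -> obind par (h s) = obind h (par s)
    & forall s t, h s = Some t -> h t = None].
Proof.
case=> r rP r01.
have [child childP] : exists child : S -> S -> S, forall s u v,
    r u v -> par s = Some u -> par (child s v) = Some v /\ r s (child s v).
  have /choice [f fP] (p : S * S) : exists v', forall u, r u p.2 ->
      par p.1 = Some u -> par v' = Some p.2 /\ r p.1 v'.
    case: (pselect (exists2 u, r u p.2 & par p.1 = Some u)) => [[u ru pu]|no].
      have [_ /(_ _ pu) [v' v'P rv']] := rP _ _ ru.
      by exists v' => u' _ _.
    by exists p.1 => u ru pu; case: no; exists u.
  by exists (fun s v => f (s, v)) => s u v; apply: (fP (s, v)).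
(* The recursion passes to the parent, where the depth is one less, so the depth of [s] is enough
   fuel. *)
pose H := fix H n s := if s == s0 then Some s1 else
  if n is n'.+1 then obind (fun t => omap (child s) (H n' t)) (par s) else None.
pose h s := H (node_depth s) s.
have hE s : h s = if s == s0 then Some s1 else
    obind (fun t => omap (child s) (h t)) (par s).
  rewrite /h; case es: (par s) => [t|] /=.
    by rewrite (node_depth_par es) /= es.
  by case: (node_depth s) => [|n] /=; rewrite ?es.
have hr s v : h s = Some v -> r s v.
  have [n] := ubnP (node_depth s); elim: n s v => // n IH s v le_n.
  rewrite hE; case: eqP => [-> [<-] //|_].
  case es: (par s) => [t|] //=; case et: (h t) => [w|] //= [<-].
  have rtw : r t w by apply: IH et; rewrite -ltnS -(node_depth_par es).
  by have [] := childP s t w rtw es.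
have h_par s v : s != s0 -> h s = Some v ->
    exists t w, [/\ par s = Some t, h t = Some w & par v = Some w].
  move=> ss0; rewrite hE (negPf ss0); case es: (par s) => [t|] //=.
  case et: (h t) => [w|] //= [<-]; exists t, w; split=> //.
  by have [] := childP s t w (hr _ _ et) es.
have h_depth s v : h s = Some v -> (node_depth s0 <= node_depth s)%N.
  have [n] := ubnP (node_depth s); elim: n s v => // n IH s v le_n hs.
  have [-> //|/h_par] := eqVneq s s0; move=> /(_ v hs) [t [w [st tw _]]].
  rewrite (node_depth_par st) ltnW // ltnS; apply: IH tw.
  by rewrite -ltnS -(node_depth_par st).
have h_pos s t : h s = Some t -> pos s = pos t by move=> /hr /rP [].
exists h; split=> //; first by rewrite hE eqxx.
  move=> s ss0; case hs: (h s) => [v|] /=.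
    by have [t [w [-> /= ->]]] := h_par _ _ ss0 hs.
  have := hs; rewrite hE (negPf ss0); case: (par s) => [t|] //=.
  by case: (h t).
move=> s t; have [n] := ubnP (node_depth s); elim: n s t => // n IH s t le_n hs.
have no_parent u : (node_depth u < node_depth s0)%N -> h u = None.
  by case hu: (h u) => [v|] //; rewrite ltnNge (h_depth _ _ hu).
have [ss0|ss0] := eqVneq s s0.
  move: hs; rewrite ss0 hE eqxx => -[<-].
  by rewrite hE eq_sym (negPf s01) par1 /= no_parent // (node_depth_par par0).
have [u [v [su uv tv]]] := h_par _ _ ss0 hs.
have hv : h v = None by apply: IH uv; rewrite -ltnS -(node_depth_par su).
rewrite hE; case: eqP => [ts0|_]; last by rewrite tv /= hv.
have := h_depth _ _ uv; rewrite -ts0 (node_depth_par tv) /node_depth (h_pos _ _ uv).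
by rewrite ltnn.
Qed.

(* Subtracting from the basis vectors of the branch at [s0] their images in the
   branch at [s1] disconnects the branch at [s0]. *)
Lemma framing_cut V : sim s0 s1 -> framing V S -> framed V cut_forest.
Proof.
move=> /branch_map [h [h0 h_pos h_par hh]] F.
pose ofb x o := oapp (fb F x) 0 o.
have ofb_off x s : pos s != x -> ofb x (h s) = 0.
  move=> sx; rewrite /ofb; case hs: (h s) => [t|] //=.
  by rewrite fb_off // -(h_pos _ _ hs).
have fc_ofb x s o : oapp (fun t => pos t == x) true o ->
    fc F s (ofb x o) = (o == Some s)%:R.
  rewrite /ofb; case: o => [t|] /=; last by rewrite linear0.
  by move=> /eqP tx; rewrite fc_fb // eq_sym.
have h_over x s : pos s = x -> oapp (fun t => pos t == x) true (h s).
  by move=> sx; case hs: (h s) => [t|] //=; rewrite -(h_pos _ _ hs) sx.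
(* The change of basis is [1 - h] with [h] of square zero, so its inverse is [1 + h]: the coordinate
   at [s] gains the coordinates of the nodes sent to [s]. *)
split; exists (fun x (s : cut_forest) => fb F x s - ofb x (h s))
  (fun x (s : cut_forest) v => fc F s v + \sum_(t | h t == Some s) fc F t v).
- move=> x s c u v; rewrite linearP mulrDr addrACA; congr (_ + _).
  by rewrite mulr_sumr -big_split; apply: eq_bigr => t _; rewrite linearP.
- by move=> x s sx; rewrite fb_off // ofb_off // subrr.
- move=> x s t tx; rewrite linearB /= fc_fb // fc_ofb ?h_over //.
  under eq_bigr => u _ do rewrite linearB /= fc_fb // fc_ofb ?h_over //.
  rewrite sumrB [X in _ + (_ - X)]big1 => [|u /eqP hu]; last first.
    by case: eqP => // /hh; rewrite hu.
  rewrite subr0 big_mkcond (bigD1 t) //= eqxx big1 => [|u /negPf ut].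
    by rewrite addr0; case: ifP => _; rewrite subrK.
  by rewrite ut if_same.
- move=> x v; under eq_bigr do rewrite scalerDl scalerBr.
  rewrite big_split sumrB /= fb_sum -addrA; apply/eqP.
  rewrite -subr_eq0 [X in X - _]addrC addrK addrC subr_eq0; apply/eqP.
  under eq_bigr do rewrite scaler_suml.
  rewrite (exchange_big_dep xpredT) //=; apply: eq_bigr => t _.
  rewrite /ofb; case ht: (h t) => [u|] /=.
    rewrite (big_pred1 u) => [|s]; last by rewrite eqE /= eq_sym.
    by rewrite (hh _ _ ht) subr0.
  by rewrite scaler0 big_pred0.
move=> a s sa; have map_ofb o : oapp (fun t => pos t == src a) true o ->
    rep_map V a (ofb (src a) o) = ofb (tgt a) (obind par o).
  rewrite /ofb; case: o => [t|] /=; last by rewrite linear0.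
  by move=> /eqP ta; rewrite fb_map.
rewrite linearB /= (map_ofb (h s)) ?h_over //.
rewrite -[fb F (src a) s]/(ofb (src a) (Some s)) map_ofb /= ?sa //.
(* The vectors at [s0] and [s1] are both mapped to the one at [u0], so the difference is killed and
   [s0] becomes a root. *)
rewrite /cut_par; case: eqVneq => [->|ss0].
  by rewrite h0 par0 /= par1 subrr.
by rewrite h_par //; case: (@par Q S s) => [t|] //=; rewrite /ofb subrr.
Qed.

End Cut.

(** Every cut lowers the number of nodes that have a parent. *)
Lemma framed_reduced V S : framed V S -> exists2 T : forest Q, framed V T & reduced T.
Proof.
have [n] := ubnP #|[pred s : S | par s : bool]|; elim: n S => // n IH S le_n [F].
case: (pselect (reduced S)) => [red|]; first by exists S.
move=> /existsNP [s /existsNP [t /existsNP [u]]].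
move=> /not_implyP [st /not_implyP [su /not_implyP [tu /contrapT st_sim]]].
apply: IH (framing_cut st su tu st_sim F).
rewrite -ltnS; apply: leq_trans le_n; rewrite ltnS; apply: proper_card.
apply/properP; split.
  apply/fintype.subsetP => x; rewrite !inE /par /= /cut_par.
  by case: eqP.
exists s; first by rewrite inE su.
by rewrite inE /par /= /cut_par eqxx.
Qed.

End Reduction.

(** * Reduced trees have local endomorphism rings *)

Section Local.
Variables (k : fieldType) (Q : rooted_tree_quiver).
Implicit Types (V W : rep k Q) (S : forest Q).

Definition has_root S (r : S) := forall s : S, par s = None <-> s = r.

(** The root has minimal depth, and a node with a parent is strictly deeper than that parent. *)
Lemma pos_root S (r s : S) : has_root r -> pos s = pos r -> s = r.
Proof.
move=> rP; have r_le (t : S) : (node_depth r <= node_depth t)%N.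
  have [n] := ubnP (node_depth t); elim: n t => // n IH t.
  case tu: (par t) => [u|]; last by rewrite ((rP _).1 tu).
  rewrite (node_depth_par tu) ltnS => le_n.
  by apply: leq_trans (IH _ le_n) _.
move=> sr; apply: (rP s).1; case su: (par s) => [u|] //.
have rs : node_depth r = node_depth s by rewrite /node_depth sr.
by have := r_le u; rewrite rs (node_depth_par su) ltnn.
Qed.

Section Triangular.
(** [m s t] models the coefficient at [s] of the image of the basis vector [t] under an
    endomorphism; [m_par] expresses commutation with the arrows. *)
Variables (S : forest Q) (r : S) (m : S -> S -> k).
Hypotheses (red : reduced S) (rP : has_root r).
Hypothesis m_off : forall s t, m s t != 0 -> pos s = pos t.
Hypothesis m_par : forall t t' u, par t = Some t' ->
  m u t' = \sum_(s | par s == Some u) m s t.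

(** Having a nonzero coefficient is itself a simulation: [m_par] writes [m v u] as a sum over the
    children of [v], of which some term must be nonzero. *)
Lemma coef_sim (s t : S) : m s t != 0 -> sim t s.
Proof.
exists (fun u v => m v u != 0) => // u v vu; split; first by rewrite (m_off vu).
move=> u' uu'; have := vu; rewrite (m_par v uu') => /eqP nz.
case: (pselect (exists2 v', par v' = Some v & m v' u' != 0)) => // no.
case: nz; apply: big1 => w /eqP wv; apply/eqP/contraT => w0.
by case: no; exists w.
Qed.

(** For a child [t] of [u], [m_par] expands [m u u] over the siblings of [t], and reducedness leaves
    only [m t t]. *)
Lemma coef_diag (t : S) : m t t = m r r.
Proof.
have [n] := ubnP (node_depth t); elim: n t => // n IH t.
case tu: (par t) => [u|]; last by rewrite ((rP _).1 tu).
rewrite (node_depth_par tu) ltnS => le_n; rewrite -(IH _ le_n) (m_par u tu).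
rewrite (bigD1 t) ?tu //= big1 ?addr0 // => s /andP [/eqP su st].
apply/eqP/contraT => /coef_sim st_sim.
by case: (red _ tu su st_sim); rewrite eq_sym.
Qed.

(** [rho] is monotone along [sim], strictly unless the simulation can be reversed. Its values are
    below [N], so they serve as digits in base [N]: [mu t] has leading digit [rho t], followed by
    those of the ancestors. *)
Let N := #|S|.+1.
Let rho (t : S) := #|[pred s : S | `[< sim s t >]]|.
Let M := fix M n (t : S) := if n is n'.+1 then
  (rho t * N ^ n' + oapp (M n') 0 (par t))%N else 0%N.
Let mu t := M (node_depth t).+1 t.

Let M_lt n t : (M n t < N ^ n)%N.
Proof.
elim: n t => //= n IH t; rewrite expnS.
have lt_n : (oapp (M n) 0 (par t) < N ^ n)%N.
  by case: (par t) => [u|] /=; rewrite ?IH // expn_gt0.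
apply: (@leq_trans ((rho t).+1 * N ^ n)); first by rewrite mulSn addnC ltn_add2r.
by rewrite leq_mul2r ltnS max_card orbT.
Qed.

Let mu_par t u : par t = Some u -> mu t = (rho t * N ^ node_depth t + mu u)%N.
Proof. by move=> tu; rewrite /mu /= tu /= (node_depth_par tu). Qed.

Let rho_sim (s t : S) : sim s t -> (rho s <= rho t)%N.
Proof.
move=> st; apply/subset_leq_card/fintype.subsetP => u; rewrite !inE.
by move=> us; apply: sim_trans us st.
Qed.

Let rho_lt (s t : S) : sim s t -> ~ sim t s -> (rho s < rho t)%N.
Proof.
move=> st ts; apply/proper_card/properP; split.
  apply/fintype.subsetP => u; rewrite !inE.
  by move=> us; apply: sim_trans us st.
exists t; rewrite !inE; first exact: sim_refl.
by apply/asboolP.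
Qed.

(* [m] is triangular with constant diagonal with respect to [mu], which encodes
   the lexicographic order on the values of [rho] from a node to the root. *)
Lemma coef_triangular : exists mu : S -> nat,
  forall s t, s != t -> m s t != 0 -> (mu t < mu s)%N.
Proof.
exists mu => s t; have [n] := ubnP (node_depth t).
elim: n s t => // n IH s t le_n st m_st.
have st_sim := coef_sim m_st; have st_pos := m_off m_st.
have st_depth : node_depth s = node_depth t by rewrite /node_depth st_pos.
(* Without a simulation back, the leading digit of [mu s] is already larger. *)
case: (pselect (sim s t)) => [ts_sim|ts_sim]; last first.
  have lt_rho := rho_lt st_sim ts_sim.
  apply: (@leq_trans ((rho t).+1 * N ^ node_depth t)).
    rewrite /mu /= mulSn addnC ltn_add2r.
    case: (par t) => [u|] /=; rewrite ?M_lt // expn_gt0 //.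
  apply: (@leq_trans (rho s * N ^ node_depth t)); first by rewrite leq_mul2r lt_rho orbT.
  by rewrite /mu /= st_depth leq_addr.
(* The leading digits agree, so the parents are compared. They differ, as [s] and [t] would
   otherwise be siblings, and [m s' t' = m s t], since a nonzero coefficient at another child of
   [s'] would make [s] simulate into a sibling. *)
have eq_rho : rho s = rho t.
  by apply/eqP; rewrite eqn_leq !rho_sim.
case tt': (par t) => [t'|]; last first.
  by case/eqP: st; rewrite ((rP _).1 tt') in st_pos *; apply: (pos_root rP).
case ss': (par s) => [s'|]; last first.
  by case/eqP: st; rewrite ((rP _).1 ss') in st_pos *; apply/esym/(pos_root rP).
rewrite (mu_par tt') (mu_par ss') eq_rho st_depth ltn_add2l.
apply: IH.
- by rewrite -ltnS -(node_depth_par tt').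
- apply/eqP => s't'; apply: (red st ss' _ ts_sim).
  by rewrite s't'.
rewrite (m_par s' tt') (bigD1 s) ?ss' //= big1 ?addr0 // => u /andP [/eqP us' us].
apply/eqP/contraT => /coef_sim tu.
by case: (red _ ss' us' (sim_trans ts_sim tu)); rewrite eq_sym.
Qed.

End Triangular.

(** An endomorphism with nonzero diagonal value is injective by triangularity, hence invertible. If
    the diagonal value of [f] is 0, that of [f - 1] is -1. *)
Lemma local_reduced V S (r : S) : framing V S -> reduced S -> has_root r -> local V.
Proof.
move=> F red rP.
pose mat (f : rep_hom V V) s t := fc F s (f (pos t) (fb F (pos t) t)).
have inv f : mat f r r != 0 -> invertible f.
  move=> f0; apply: injective_invertible => x v fv.
  have matE s t : pos t = x -> fc F s (f x (fb F x t)) = mat f s t.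
    by move=> tx; rewrite /mat tx.
  have m_off s t : mat f s t != 0 -> pos s = pos t.
    by move=> st; apply/eqP; apply: contraNT st => st; rewrite /mat fc_off.
  have m_par t t' u : par t = Some t' ->
      mat f u t' = \sum_(s | par s == Some u) mat f s t.
    move=> tt'; have [a [ta ta']] := par_arrow tt'.
    have fbt : fb F (tgt a) t' = rep_map V a (fb F (src a) t).
      by rewrite fb_map // tt'.
    rewrite /mat ta ta' fbt rep_homE -{1}(fb_sum F (f _ _)) !linear_sum /=.
    rewrite [RHS]big_mkcond; apply: eq_bigr => s _; rewrite !linearZ /=.
    have [sa|sa] := eqVneq (pos s) (src a); last first.
      by rewrite fc_off // mul0r if_same.
    rewrite fb_map //; case su: (par s) => [w|] /=; last by rewrite linear0 mulr0.
    rewrite fc_fb; last exact: pos_par sa su.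
    by rewrite (inj_eq Some_inj) eq_sym; case: eqP; rewrite ?mulr1 ?mulr0.
  have [mu mu_lt] := coef_triangular red rP m_off m_par.
  apply: (framing_eq (F := F)) => s0 s0x; rewrite linear0.
  apply/eqP/contraT => v0.
  (* At a node of the support of [v] with least [mu], only the diagonal term contributes to the
     coefficient of [f v]. *)
  have [s sv smin] := @arg_minnP _ s0 (fun s => fc F s v != 0) mu v0.
  have sx : pos s = x by apply/eqP; apply: contraNT sv => /(fc_off F v) ->.
  have : fc F s (f x v) = 0 by rewrite fv linear0.
  rewrite -{1}(fb_sum F v) !linear_sum (bigD1 s) //= !linearZ /= matE //.
  rewrite (coef_diag red rP m_off m_par) big1 ?addr0 => [|t ts].
    by move/eqP; rewrite mulf_eq0 (negPf sv) (negPf f0).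
  have [tx|tx] := eqVneq (pos t) x; last by rewrite (fc_off F v tx) scale0r !linear0.
  rewrite !linearZ /= matE //; apply/eqP; rewrite mulf_eq0 orbC.
  apply/contraT; rewrite negb_or => /andP [st /smin].
  by rewrite leqNgt mu_lt // eq_sym.
move=> f; have [f0|] := eqVneq (mat f r r) 0; last by left; apply: inv.
right; apply: inv; rewrite /mat hom_subE hom_idE linearB /= -/(mat f r r) f0.
by rewrite sub0r oppr_eq0 fc_fb // eqxx oner_eq0.
Qed.

Section RootComponents.
Variable S : forest Q.

Definition climb (s : S) := odflt s (par s).
(** The depth bounds the number of ancestors, and [climb] fixes roots, so surplus iterations are
    harmless when the root has positive depth. *)
Definition top_node (s : S) := iter (node_depth s) climb s.

Lemma top_node_par s t : par s = Some t -> top_node s = top_node t.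
Proof.
by move=> st; rewrite /top_node (node_depth_par st) iterSr /climb st.
Qed.

Lemma top_node_id s : par s = None -> top_node s = s.
Proof.
by move=> s0; rewrite /top_node; elim: (node_depth s) => //= n ->; rewrite /climb s0.
Qed.

Lemma par_top_node s : par (top_node s) == None.
Proof.
have [n] := ubnP (node_depth s); elim: n s => // n IH s.
case st: (par s) => [t|]; last by rewrite top_node_id ?st.
by rewrite (top_node_par st) (node_depth_par st); apply: IH.
Qed.

Definition root_of (s : S) : {r : S | par r == None} :=
  exist _ (top_node s) (par_top_node s).

Lemma root_of_par s t : par s = Some t -> root_of s = root_of t.
Proof. by move=> st; apply: val_inj; rewrite /= (top_node_par st). Qed.

Definition component := fiber_forest root_of.

Lemma component_has_root i : exists r : component i, has_root r.
Proof.
have r_i : root_of (val i) == i.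
  by apply/eqP/val_inj; rewrite /= top_node_id //; apply/eqP/(valP i).
exists (exist _ (val i) r_i) => s; rewrite [par s = None](fiber_par_none root_of_par s).
split=> [s0|->]; last exact/eqP/(valP i).
by apply: val_inj; rewrite /= -[in RHS](eqP (valP s)) /= top_node_id.
Qed.

(** A simulation inside a component is one in [S], because children of a node lie in its
    component. *)
Lemma reduced_component i : reduced S -> reduced (component i).
Proof.
move=> red s t u st su tu [R RP Rst].
apply: (red (val s) (val t) (val u)); first by rewrite (inj_eq val_inj).
- exact/fiber_parE.
- exact/fiber_parE.
exists (fun x y => exists x' y' : component i,
  [/\ val x' = x, val y' = y & R x' y']); last by exists s, t.
move=> x y [x' [y' [<- <- Rxy]]]; have [pxy xyP] := RP _ _ Rxy.
split=> [|w wx]; first exact: pxy.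
have wi : root_of w == i by rewrite (root_of_par wx) (valP x').
have wx' : par (exist _ w wi : component i) = Some x'.
  by apply/fiber_parE.
have [z /fiber_parE zy Rwz] := xyP _ wx'.
by exists (val z) => //; exists (exist _ w wi), z.
Qed.

Lemma framed_components V : framed V S ->
  sums_of (fun W => exists i, framed W (component i)) V.
Proof.
case=> /(framing_fibers root_of_par) [W [WP VW]].
by exists _, W; split=> // i; exists i; apply: WP.
Qed.

End RootComponents.

(** The forest counterpart of [rooted_tree_module]; its root may lie over any vertex. *)
Definition tree_like V := exists (S : forest Q) (r : S), framed V S /\ has_root r.

(** After reduction, the components of the forest give summands of [V] with local endomorphism
    rings. The summand [W] is a retract of their sum, so [krull_schmidt] applies. *)
Lemma summand_tree_like V W S : framed V S -> direct_summand W V ->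
  sums_of tree_like W.
Proof.
move=> /framed_reduced [T TV Tred] [W' /sum_decompositionP [i_ [p_ [pi _ _]]]].
pose P (U : rep k Q) := exists i, framed U (@component T i).
have Ploc U : P U -> local U.
  case=> i [F]; have [r rP] := component_has_root i.
  exact: local_reduced F (reduced_component Tred) rP.
apply: (@sums_of_sub _ _ P) => [U [i TU]|].
  by have [r rP] := component_has_root i; exists (component i), r.
have [I [X [XP [iX [pX [_ _ piX]]]]]] := framed_components TV.
pose iW : rep_hom W V := i_ true; pose pW : rep_hom V W := p_ true.
apply: (@krull_schmidt k Q P #|I| (fun j => X (enum_val j)) Ploc _ W
  (fun j => hom_comp (pX (enum_val j)) iW) (fun j => hom_comp pW (iX (enum_val j)))).
  by move=> j; apply: XP.
move=> x w; under eq_bigr do rewrite !hom_compE.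
rewrite -linear_sum; rewrite -[RHS](pi true); congr (pW x _).
rewrite -[RHS]piX [RHS](reindex (@enum_val _ predT)) //=.
by apply: onW_bij; apply: enum_val_bij.
Qed.

End Local.

(** * Rooted tree modules *)

Section RootedTreeModules.
Variables (k : fieldType) (Q : rooted_tree_quiver).
Implicit Types (V W : rep k Q) (S : forest Q).

(** Passes from genuine bases, one per vertex, to a framing with vectors extended by zero; [g x]
    identifies [J x] with the nodes over [x]. *)
Lemma framing_of_bases V S (J : vertex Q -> finType) (g : forall x, J x -> S)
    (eb : forall x, J x -> V x) (cb : forall x, J x -> V x -> k) :
  (forall x j, pos (g x j) = x) -> (forall x, injective (g x)) ->
  (forall s : S, exists j : J (pos s), g (pos s) j = s) ->
  (forall x j, scalar (cb x j)) ->
  (forall x i j, cb x i (eb x j) = (i == j)%:R) ->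
  (forall x v, \sum_j cb x j v *: eb x j = v) ->
  (forall a j, if par (g (src a) j) is Some t
     then exists2 j', t = g (tgt a) j' & rep_map V a (eb (src a) j) = eb (tgt a) j'
     else rep_map V a (eb (src a) j) = 0) ->
  framed V S.
Proof.
move=> pos_g g_inj g_surj cb_lin cb_eb cb_sum map_eb.
pose ginv x s := [pick j | g x j == s].
have ginvK x j : ginv x (g x j) = Some j.
  rewrite /ginv; case: pickP => [j' /eqP /g_inj -> //|/(_ j)].
  by rewrite eqxx.
have ginv_some x s j : ginv x s = Some j -> g x j = s.
  by rewrite /ginv; case: pickP => // j' /eqP e [<-].
have ginv_none x s : pos s != x -> ginv x s = None.
  move=> sx; case e: (ginv x s) => [j|] //.
  by rewrite -(ginv_some _ _ _ e) pos_g eqxx in sx.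
have surj x s : pos s = x -> exists j, g x j = s.
  by move=> <-; apply: g_surj.
split; exists (fun x s => oapp (eb x) 0 (ginv x s))
  (fun x s v => oapp (fun j => cb x j v) 0 (ginv x s)).
- move=> x s c u v; case: (ginv x s) => [j|] /=; first by rewrite cb_lin.
  by rewrite mulr0 addr0.
- by move=> x s sx; rewrite ginv_none.
- move=> x s t tx; have [j <-] := surj x t tx; rewrite ginvK /=.
  have [sx|sx] := eqVneq (pos s) x; last first.
    by rewrite ginv_none //=; case: eqP => // e; rewrite e pos_g eqxx in sx.
  have [i <-] := surj x s sx; rewrite ginvK /= cb_eb.
  by rewrite (inj_eq (g_inj x)).
- move=> x v; rewrite -[RHS]cb_sum (bigID (fun s => ginv x s : bool)) /=.
  rewrite [X in _ + X]big1 ?addr0 => [|s]; last first.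
    by case: (ginv x s) => //= _; rewrite scale0r.
  rewrite (reindex_omap (g x) (ginv x)) => [|s /=]; last first.
    by case e: (ginv x s) => [j|] //= _; rewrite (ginv_some _ _ _ e).
  by apply: eq_big => [j|j _]; rewrite ginvK ?eqxx.
move=> a s sa; have [j <-] := surj _ s sa; rewrite ginvK /=.
have := map_eb a j; case: (par _) => [t|] //= [j' -> ->].
by rewrite ginvK.
Qed.

(** Outgoing arrows of the coefficient quiver are unique, so every basis vector is mapped to a
    multiple of a single basis vector or to 0. *)
Lemma rooted_tree_module_tree_like V : rooted_tree_module V -> tree_like V.
Proof.
case=> B [B_basis [r rP]]; set G := coefficient_quiver B in r rP.
pose out s := [pick e : arrow G | src e == s].
have out_src (e : arrow G) : out (src e) = Some e.
  rewrite /out; case: pickP => [e' /eqP /(out_arrow_uniq rP) -> //|/(_ e)].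
  by rewrite eqxx.
have out_some s e : out s = Some e -> src e = s.
  by rewrite /out; case: pickP => // e' /eqP se' [<-].
have par_arr s t : omap (@tgt G) (out s) = Some t ->
    exists a, tag s = src a /\ tag t = tgt a.
  case e: (out s) => [c|] //= [<-]; exists (tag (val c)).
  by rewrite -(out_some _ _ e).
pose S : forest Q :=
  @Forest Q (vertex G) (@tag _ _) (fun s => omap (@tgt G) (out s)) par_arr.
have root_r : has_root (r : S).
  move=> s; rewrite /par /=; split=> [|->].
    case e: (out s) => [//|] _; apply/eqP/contraT.
    by move=> /(out_arrow_exists rP) [c cs]; rewrite -cs out_src in e.
  case e: (out r) => [c|] //=; have := src_neq_root rP c.
  by rewrite (out_some _ _ e) eqxx.
exists S, r; split=> //.
pose gam s := oapp (fun e : arrow G => coef B (val e)) 1 (out s).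
have gam0 s : gam s != 0.
  by rewrite /gam; case: (out s) => [e|] /=; [exact: (valP e)|exact: oner_neq0].
(* Rescaling the basis by [w] turns all nonzero coefficients into 1. *)
have [w [w0 wP]] : exists w : S -> k, (forall s, w s != 0) /\
    forall s t, par s = Some t -> w s * gam s = w t.
  pose W := fix W n (s : S) := if n is n'.+1 then
    oapp (fun t => W n' t / gam s) 1 (par s) else 1.
  exists (fun s => W (node_depth s) s); split=> [s|s t st].
    move: (node_depth s) => n; elim: n s => [|n IH] s /=; first exact: oner_neq0.
    case: (omap _ (out s)) => [t|] /=; last exact: oner_neq0.
    by rewrite mulf_neq0 ?invr_eq0.
  by rewrite (node_depth_par st); move: st; rewrite /= => -> /=; rewrite divfK.
pose b x i := (B x)`_i : V x.
pose Tg x (i : 'I_(\dim {:V x})) : S := Tagged (fun x => 'I_(\dim {:V x})) i.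
apply: (@framing_of_bases V S (fun x => 'I_(\dim {:V x})) Tg
  (fun x i => w (Tg x i) *: b x i)
  (fun x i v => (w (Tg x i))^-1 * coord (B x) i v)) => //.
- by move=> x i j; exact: eq_from_Tagged.
- by move=> [x i]; exists i.
- by move=> x i c u v; rewrite linearP mulrDr !mulrA [_^-1 * c]mulrC.
- move=> x i j; rewrite linearZ /= coord_free ?(basis_free (B_basis x)) //.
  by case: eqVneq => [->|_]; rewrite ?mulr1 ?mulVf // !mulr0.
- move=> x v; rewrite [RHS](coord_basis (B_basis x) (memvf v)).
  by apply: eq_bigr => i _; rewrite scalerA mulrAC mulVf // mul1r.
move=> a i; have arrow_at (e : arrow G) : src e = Tg _ i ->
    exists j (nz : coef B (existT _ a (i, j)) != 0), e = exist _ (existT _ a (i, j)) nz.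
  case: e => -[c [i' j]] nz /= e.
  have ca : c = a by apply: (out_arrow_uniq (rt_rooted Q)); exact: (congr1 tag e).
  subst c; have /eqP := e; rewrite eq_Tagged => /eqP /= ii'; subst i'.
  by exists j, nz.
have mapE : rep_map V a (b (src a) i) =
    \sum_j coef B (existT _ a (i, j)) *: b (tgt a) j.
  rewrite [LHS](coord_basis (B_basis (tgt a)) (memvf _)).
  by apply: eq_bigr => j _; rewrite /coef /= (tnth_nth 0).
have -> : par (Tg (src a) i) = omap (@tgt G) (out (Tg (src a) i)) by [].
case eo: (out _) => [e|] /=; last first.
  rewrite linearZ /= mapE big1 ?scaler0 // => j _.
  case: (eqVneq (coef B (existT _ a (i, j))) 0) => [->|nz].
    by rewrite scale0r.
  by have := out_src (exist _ (existT _ a (i, j)) nz); rewrite eo.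
have [j [nz ee]] := arrow_at e (out_some _ _ eo).
exists j; first by rewrite ee.
have <- : w (Tg _ i) * gam (Tg _ i) = w (Tg _ j).
  by apply: wP; rewrite /par /= eo ee.
rewrite linearZ /= mapE (bigD1 j) //= big1 ?addr0; last first.
  move=> j' jj'; case: (eqVneq (coef B (existT _ a (i, j'))) 0) => [->|nz'].
    by rewrite scale0r.
  have := out_src (exist _ (existT _ a (i, j')) nz'); rewrite eo ee => /Some_inj.
  move=> /(congr1 val) /= /eqP; rewrite eq_Tagged /= => /eqP [jj].
  by rewrite jj eqxx in jj'.
by rewrite scalerA /gam eo ee.
Qed.

End RootedTreeModules.

Section TreeLikeModules.
Variables (k : fieldType) (Q : rooted_tree_quiver).

(** In the bases read off from the framing, all coefficients are 0 or 1 and record the parent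
    relation; the depth of nodes is the rank in [rooted_treeP]. *)
Lemma tree_like_rooted_tree_module (V : rep k Q) :
  tree_like V -> rooted_tree_module V.
Proof.
case=> S [r [[F] rP]].
pose over x := [seq s <- index_enum S | pos s == x].
have over_uniq x : uniq (over x) by rewrite filter_uniq ?index_enum_uniq.
have mem_over x s : (s \in over x) = (pos s == x).
  by rewrite mem_filter mem_index_enum andbT.
have pos_nth x i : (i < size (over x))%N -> pos (nth r (over x) i) = x.
  by move=> lt_i; apply/eqP; rewrite -mem_over mem_nth.
pose bs x := [tuple of [seq fb F x s | s <- in_tuple (over x)]].
have bs_nth x (i : 'I_(size (over x))) : (bs x)`_i = fb F x (nth r (over x) i).
  by rewrite (nth_map r).
have sum_bs x (v : V x) :
    v = \sum_(i < size (over x)) fc F (nth r (over x) i) v *: (bs x)`_i.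
  rewrite -{1}(fb_sum F v) (bigID (fun s => pos s == x)) /=.
  rewrite [X in _ + X]big1 ?addr0 => [|s sx]; last by rewrite fc_off // scale0r.
  rewrite -big_filter (big_nth r) big_mkord.
  by apply: eq_bigr => i _; rewrite bs_nth.
have fc_bs x (i j : 'I_(size (over x))) :
    fc F (nth r (over x) i) (bs x)`_j = (i == j)%:R.
  by rewrite bs_nth fc_fb ?pos_nth // nth_uniq.
have bs_free x : free (bs x).
  apply/freeP => c c0 i; have := congr1 (fc F (nth r (over x) i)) c0.
  rewrite linear0 linear_sum (bigD1 i) //= linearZ /= fc_bs eqxx mulr1.
  rewrite big1 ?addr0 // => j ji.
  by rewrite linearZ /= fc_bs eq_sym (negPf ji) mulr0.
have bs_basis x : basis_of {:V x} (bs x).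
  rewrite basisEfree bs_free subvf /=; apply: leq_trans (dim_span _).
  apply/dimvS/subvP => v _; rewrite [v]sum_bs; apply: memv_suml => i _.
  by apply/memvZ/memv_span/mem_nth; rewrite size_tuple.
have bs_dim x : size (over x) = \dim {:V x} by rewrite (size_basis (bs_basis x)).
(* The number of nodes over [x] equals the dimension only by a proof, hence the cast. *)
pose B x : (\dim {:V x}).-tuple (V x) := tcast (bs_dim x) (bs x).
have B_basis x : basis_of {:V x} (B x) by rewrite val_tcast.
pose nd (v : coef_vertex V) : S := nth r (over (tag v)) (tagged v).
have nd_lt (v : coef_vertex V) : (tagged v < size (over (tag v)))%N.
  by rewrite bs_dim ltn_ord.
have pos_nd v : pos (nd v) = tag v by apply: pos_nth.
have nd_inj : injective nd.
  move=> [x i] [y j] e; have xy : x = y.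
    by have := pos_nd (existT _ x i); rewrite e pos_nd.
  subst y; congr existT; apply/val_inj/eqP.
  rewrite -(nth_uniq r _ _ (over_uniq x)).
  - exact/eqP.
  - exact: (nd_lt (existT _ x i)).
  - exact: (nd_lt (existT _ x j)).
have nd_surj s : exists v, nd v = s.
  have lt_s : (index s (over (pos s)) < \dim {:V (pos s)})%N.
    by rewrite -bs_dim index_mem mem_over.
  by exists (existT _ (pos s) (Ordinal lt_s)); rewrite /nd /= nth_index ?mem_over.
have B_nth x (i : 'I_(\dim {:V x})) :
    (B x)`_i = fb F x (nd (existT _ x i)).
  by rewrite val_tcast; apply: (bs_nth x (Ordinal (nd_lt (existT _ x i)))).
have coordB x (i : 'I_(\dim {:V x})) v :
    coord (B x) i v = fc F (nd (existT _ x i)) v.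
  rewrite /B /nd /=; case: _ / (bs_dim x) i => i.
  by rewrite {1}[v]sum_bs coord_sum_free.
have coefE (e : coef_index V) : coef B e =
    (par (nd (existT _ (src (tag e)) (tagged e).1)) ==
     Some (nd (existT _ (tgt (tag e)) (tagged e).2)))%:R.
  rewrite /coef coordB (tnth_nth 0) B_nth fb_map ?pos_nd //.
  case es: (par _) => [t|] /=; last by rewrite linear0.
  rewrite fc_fb ?(inj_eq Some_inj) 1?eq_sym //.
  by apply: pos_par es; rewrite pos_nd.
have par_arr (e : arrow (coefficient_quiver B)) : par (nd (src e)) = Some (nd (tgt e)).
  by have := valP e; rewrite coefE; case: (par _ =P _) => // _; rewrite eqxx.
exists B; split=> //; have [v0 v0r] := nd_surj r; exists v0.
apply: (@rooted_treeP (coefficient_quiver B) v0 (fun v => node_depth (nd v))).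
- by move=> e; rewrite (node_depth_par (par_arr e)).
- move=> [x i] xr; case es: (par (nd (existT _ x i))) => [t|]; last first.
    case/eqP: xr; apply: nd_inj; rewrite v0r; exact/(rP _).1.
  have [[y j] jt] := nd_surj t; have [a [xa ya]] := par_arrow es.
  rewrite pos_nd /= in xa; rewrite -jt pos_nd /= in ya; subst x y.
  have nz : coef B (existT _ a (i, j)) != 0.
    by rewrite coefE /= es jt eqxx oner_neq0.
  by exists (exist _ (existT _ a (i, j)) nz).
- move=> e; apply/eqP => er; have := par_arr e.
  by rewrite er v0r (rP r).2.
move=> e e' ee'; have := par_arr e; rewrite ee' par_arr => -[/nd_inj tt'].
move: e e' ee' tt' => [[a [i j]] nz] [[a' [i' j']] nz'] /= ee' tt'.
have aa' : a = a' by apply: (out_arrow_uniq (rt_rooted Q)); exact: (congr1 tag ee').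
subst a'; apply: val_inj => /=; congr existT; congr (_, _).
  by have /eqP := ee'; rewrite eq_Tagged => /eqP.
by have /eqP := tt'; rewrite eq_Tagged => /eqP /= ->.
Qed.

End TreeLikeModules.

(** * Linearizations of rooted trees *)

Section Linearization.
Variables (k : fieldType) (Q : rooted_tree_quiver).

(** Such forests amount to functors from [Q] to finite sets: every node not over the root has an
    image along the outgoing arrow. *)
Definition total (S : forest Q) := forall s : S, par s = None <-> pos s = rt_root Q.

Section TreeForest.
Variable T : rooted_tree_over Q.

Let out (s : vertex T) := [pick e : arrow T | src e == s].

Let out_src e : out (src e) = Some e.
Proof.
rewrite /out; case: pickP => [e' /eqP /(out_arrow_uniq (rt_rooted T)) -> //|/(_ e)].
by rewrite eqxx.
Qed.

Fact tree_forest_subproof s t : omap (@tgt T) (out s) = Some t ->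
  exists a, qh0 (rto_hom T) s = src a /\ qh0 (rto_hom T) t = tgt a.
Proof.
rewrite /out; case: pickP => // e /eqP <- [<-].
by exists (qh1 (rto_hom T) e); rewrite qh_src qh_tgt.
Qed.

Definition tree_forest : forest Q :=
  @Forest Q (vertex T) (qh0 (rto_hom T)) (fun s => omap (@tgt T) (out s))
    tree_forest_subproof.

Lemma tree_forest_par e : par (src e : tree_forest) = Some (tgt e).
Proof. by rewrite /par /= out_src. Qed.

Lemma tree_forest_total : total tree_forest.
Proof.
move=> s; split=> [s0|sr]; last first.
  rewrite /par /=; case e: (out s) => [c|] //; move: e sr.
  rewrite /out; case: pickP => // b /eqP <- _; rewrite /pos /= qh_src.
  by move=> /eqP; rewrite (negPf (src_neq_root (rt_rooted Q) _)).
have [->|/(out_arrow_exists (rt_rooted T)) [e es]] := eqVneq s (rt_root T).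
  exact: rto_root.
by rewrite -es tree_forest_par in s0.
Qed.

(** A vertex of [T] over [src a] is not the root, and its outgoing arrow lies over [a] by uniqueness
    in [Q]; this is the only arrow contributing to [push_fun] at that vertex. *)
Lemma framed_linearization : framed (linearization k T) tree_forest.
Proof.
pose J x := fiber0 (rto_hom T) x.
pose one x (j : J x) : linearization k T x :=
  @dsum_in _ _ (fun y : J x => k^o) j 1.
apply: (@framing_of_bases k Q _ tree_forest J (fun x j => val j)
  one (fun x j (u : dsum (fun y : J x => k^o)) => u j)).
- by move=> x j; apply/eqP; apply: (valP j).
- by move=> x; apply: val_inj.
- by move=> s; exists (exist _ s (eqxx _)).
- by move=> x j c u v; rewrite dsumDE dsumZE.
- move=> x i j; rewrite /one ffunE; case: (eqVneq i j) => [->|ij].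
    by rewrite dfwith_in.
  by rewrite dfwith_out // eq_sym.
- move=> x v; rewrite [RHS]dsum_in_sum; apply: eq_bigr => j _.
  rewrite /one -linearZ /=; congr (dsum_in _).
  by rewrite /GRing.scale /= mulr1.
move=> a j; have ja : qh0 (rto_hom T) (val j) = src a by apply/eqP/(valP j).
have jr : val j != rt_root T.
  apply/eqP => jr; have /eqP := src_neq_root (rt_rooted Q) a; case.
  by rewrite -ja jr rto_root.
have [e ej] := out_arrow_exists (rt_rooted T) jr.
have ea : qh1 (rto_hom T) e == a.
  by apply/eqP/(out_arrow_uniq (rt_rooted Q)); rewrite -qh_src ej.
pose b : fiber1 (rto_hom T) a := exist _ e ea.
have bj : fiber_src b = j by apply: val_inj.
rewrite -ej tree_forest_par; exists (fiber_tgt b) => //.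
rewrite /= lfunE /= /push_fun (bigD1 b) //= big1 ?addr0 => [|c cb].
  rewrite /one; congr (@dsum_in _ _ _ _ _).
  by rewrite bj ffunE dfwith_in lfunE.
rewrite /one ffunE dfwith_out ?linear0 //.
apply: contraNneq cb => jc; apply/eqP/val_inj/(out_arrow_uniq (rt_rooted T)).
by rewrite -[src (val c)]/(val (fiber_src c)) -jc -ej.
Qed.

End TreeForest.

Lemma linearized_framed (V : rep k Q) : linearized_rooted_tree V ->
  exists2 S, total S & framed V S.
Proof.
case=> T VT; exists (tree_forest T); first exact: tree_forest_total.
have [F] := framed_linearization T.
exact: framing_transport (rep_iso_sym VT) F.
Qed.

Section ForestTree.
Variables (S : forest Q) (r : S).
Hypotheses (tot : total S) (rP : has_root r).

(** A node with a parent serves as its own outgoing arrow; the default of [odflt] is never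
    reached. *)
Definition forest_quiver : quiver := @Quiver S {s : S | par s : bool}
  (fun e => val e) (fun e => odflt (val e) (par (val e))).

Lemma forest_quiver_par (e : arrow forest_quiver) : par (src e) = Some (tgt e).
Proof. by case: e => s /=; case: (par s). Qed.

Fact forest_quiver_rooted : @is_rooted_tree forest_quiver r.
Proof.
apply: (@rooted_treeP forest_quiver r (fun s : S => node_depth s)).
- by move=> e; rewrite (node_depth_par (forest_quiver_par e)).
- move=> s sr; have sp : par s : bool.
    by case e: (par s) => [t|] //; move: sr; rewrite ((rP s).1 e) eqxx.
  by exists (exist _ s sp).
- move=> e; apply/eqP => er; have := forest_quiver_par e.
  by rewrite er (rP r).2.
by move=> e e'; apply: val_inj.
Qed.

Lemma framed_linearized (V : rep k Q) : framed V S -> linearized_rooted_tree V.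
Proof.
case=> F; have [arr arrP] := choice (fun e => par_arrow (forest_quiver_par e)).
pose f : quiver_hom forest_quiver Q :=
  @QuiverHom forest_quiver Q pos arr (fun e => (arrP e).1) (fun e => (arrP e).2).
pose T : rooted_tree_over Q := @RootedTreeOver Q
  (RootedTreeQuiver forest_quiver_rooted) f ((tot r).1 ((rP r).2 erefl)).
exists T; have [G] := framed_linearization T.
(* The parent maps of [tree_forest T] and [S] agree only pointwise, so the framing is transferred
   field by field. *)
apply: framing_iso F _; case: G => fb fc fc_lin fb_off fc_fb fb_sum fb_map.
apply: (@Framing k Q _ S fb fc) => // a s sa; rewrite fb_map //.
have -> : @par Q (tree_forest T) s = @par Q S s; last by [].
case e: (@par Q S s) => [t|].
  have sp : par s : bool by rewrite e.
  rewrite -[s in LHS]/(@src T (exist _ s sp)) tree_forest_par /=.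
  by rewrite e.
by apply/(tree_forest_total (T := T) s); apply/(tot s).
Qed.

End ForestTree.

Lemma framed_sum_linearized (V : rep k Q) S : total S -> framed V S ->
  finite_sum_of (@linearized_rooted_tree k Q) V.
Proof.
move=> tot /framed_components; rewrite finite_sum_ofP; apply: sums_of_sub => W [i WS].
have [r rP] := component_has_root i; apply: (framed_linearized _ rP) WS.
move=> s; rewrite [par s = None](fiber_par_none (@root_of_par Q S) s).
exact: tot.
Qed.

Lemma sum_linearized_framed (V : rep k Q) :
  finite_sum_of (@linearized_rooted_tree k Q) V -> exists2 S, total S & framed V S.
Proof.
rewrite finite_sum_ofP => -[I [W [PW VW]]].
have /choice [S SP] i : exists S, total S /\ framed (W i) S.
  by have [S] := linearized_framed (PW i); exists S.
exists (forest_sum S); last exact: framing_sum VW (fun i => (SP i).2).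
move=> [i s]; rewrite -(SP i).1 /=.
by split; case: (@par Q (S i) s).
Qed.

End Linearization.

(** * Zeroth homology *)

Section ZerothHomology.
Variables (k : fieldType) (R : realType).

(** The linear extension of [phi] to chains vanishes on boundaries, so it descends to homology. *)
Lemma H0_functional (X : ftop R) (phi : X -> k) :
  (forall g : simplex1 R X, phi (g 0) = phi (g 1)) ->
  exists2 f : H0 k X -> k, scalar f & forall x, f (H0_pi << x >>) = phi x.
Proof.
move=> phi_simplex; pose ev : {freeg X / k} -> k^o := fglift (phi : X -> k^o).
have evD u v : ev (u - v) = ev u - ev v by rewrite /ev raddfB.
have ev_bdry (s : {freeg (simplex1 R X) / k}) : ev (bdry1 s) = 0.
  rewrite /ev -(freeg_sumE s) !raddf_sum big1 // => g _ /=.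
  rewrite /bdry1 liftU linearZ /= raddfB /= !liftU !scale1r.
  by rewrite phi_simplex subrr scaler0.
have evE c : ev (coker_repr (H0_pi c)) = ev c.
  have /H0_piP [s ds] := coker_reprK (H0_pi c).
  by apply/eqP; rewrite -subr_eq0 -evD -ds ev_bdry.
exists (fun c => ev (coker_repr c)) => [a u v|x].
  rewrite -[u]coker_reprK -[v]coker_reprK.
  move: (coker_repr u) (coker_repr v) => {u v} c d.
  rewrite -/(H0_pi c) -/(H0_pi d) -linearP !evE /ev.
  by rewrite linearP.
by rewrite evE /ev liftU scale1r.
Qed.

Lemma H0_span (X : ftop R) (v : H0 k X) :
  exists (r : seq X) (c : X -> k), v = \sum_(x <- r) c x *: H0_pi << x >>.
Proof.
pose c := coker_repr v; exists (dom c), (fun x => coeff x c).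
have <- : H0_pi c = v by apply: coker_reprK.
rewrite -[LHS](congr1 (@H0_pi k R X) (freeg_sumE c)) raddf_sum.
apply: eq_bigr => x _; rewrite -linearZ; congr (H0_pi _).
by apply/eqP/freeg_eqP => y; rewrite coeffZ !coeffU mul1r.
Qed.

(** Indicators of labels are constant along paths and induce the coordinate functionals; classes of
    points span by [H0_span]. *)
Lemma H0_bases (X : ftop R) (J : finType) (kappa : X -> J) :
  (forall j, exists x, kappa x = j) ->
  (forall g : simplex1 R X, kappa (g 0) = kappa (g 1)) ->
  (forall x y, kappa x = kappa y -> H0_pi << x >> = H0_pi << y >> :> H0 k X) ->
  exists (eb : J -> H0 k X) (cb : J -> H0 k X -> k),
    [/\ forall j, scalar (cb j),
        forall i j, cb i (eb j) = (i == j)%:R,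
        forall v, \sum_j cb j v *: eb j = v
      & forall x, eb (kappa x) = H0_pi << x >>].
Proof.
move=> /choice [r rK] kappa_simplex kappa_pi.
have /choice [cb cbP] j : exists f : H0 k X -> k,
    scalar f /\ forall x, f (H0_pi << x >>) = (j == kappa x)%:R.
  have [|f f_lin fE] := @H0_functional X (fun x => (j == kappa x)%:R).
    by move=> g; rewrite kappa_simplex.
  by exists f.
have eb_kappa x : H0_pi << r (kappa x) >> = H0_pi << x >> :> H0 k X.
  by apply: kappa_pi; rewrite rK.
exists (fun j => H0_pi << r j >>), cb; split=> //.
- by move=> j; apply: (cbP j).1.
- by move=> i j; rewrite (cbP i).2 rK.
move=> v; have [s [c ->]] := H0_span v.
pose cbL j : {scalar H0 k X} :=
  HB.pack (cb j) (GRing.isLinear.Build k _ _ _ (cb j) (cbP j).1).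
under eq_bigr => j _.
  rewrite -[cb j _]/(cbL j _) linear_sum scaler_suml.
  under eq_bigr => x _ do rewrite linearZ /= (cbP j).2.
  over.
rewrite exchange_big /=; apply: eq_bigr => x _.
rewrite (bigD1 (kappa x)) //= eqxx mulr1 eb_kappa big1 ?addr0 // => j jx.
by rewrite (negPf jx) mulr0 scale0r.
Qed.

Lemma H0_map_point (X Y : ftop R) (f : ftop_hom X Y) x :
  H0_map k f (H0_pi << x >>) = H0_pi << f x >>.
Proof.
rewrite /H0_map lfunE /= H0_map_pi; congr (H0_pi _).
by rewrite /chain0_map liftU scale1r.
Qed.

(** Homology classes of points stand in for path components, so that no concatenation of paths
    enters. *)
Lemma H0_points_finite (X : ftop R) : exists s : seq (H0 k X),
  (forall x, H0_pi << x >> \in s) /\ (forall v, v \in s -> exists x, H0_pi << x >> = v).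
Proof.
have /finite_seqP [s sE] := ftop_fin X; pose J : finType := adhoc_seq_sub_finType s.
have rP (A : J) : exists x : X, path_component R x = val A.
  have : [set` s]%classic (val A) by exact: valP.
  by rewrite -sE => -[x _ <-]; exists x.
have [r rE] := choice rP.
exists [seq H0_pi << r A >> | A <- enum J]; split=> [x|v]; last first.
  by case/mapP => A _ ->; exists (r A).
have : range (@path_component R X) (path_component R x) by exists x.
rewrite sE => xs; apply/mapP; exists (SeqSub xs); rewrite ?mem_enum //.
by apply/esym/H0_path; rewrite rE /=; apply: path_component_refl.
Qed.

Variable Q : rooted_tree_quiver.

Section DiagramForest.
Variables (J : vertex Q -> finType) (step : forall a, J (src a) -> J (tgt a)).

(** The generating arrows of the category of elements of the functor given by [J] and [step]. *)
Definition diagram_edge (s t : {x : vertex Q & J x}) := exists a (j : J (src a)),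
  s = Tagged J j /\ t = Tagged J (step j).

Let out s := [pick t | `[< diagram_edge s t >]].

Fact diagram_forest_subproof s t : out s = Some t ->
  exists a, tag s = src a /\ tag t = tgt a.
Proof.
rewrite /out; case: pickP => // u /asboolP [a [j [-> ->]]] [<-].
by exists a.
Qed.

Definition diagram_forest : forest Q := Forest diagram_forest_subproof.

Lemma diagram_forest_par a (j : J (src a)) :
  par (Tagged J j : diagram_forest) = Some (Tagged J (step j)).
Proof.
rewrite /par /= /out; case: pickP => [u /asboolP [b [i [e ->]]]|/(_ (Tagged J (step j)))].
  have ab : a = b by apply: (out_arrow_uniq (rt_rooted Q)); exact: (congr1 tag e).
  by subst b; rewrite (eq_from_Tagged e).
by move/asboolPn; case; exists a, j.
Qed.

Lemma diagram_forest_total : total diagram_forest.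
Proof.
case=> x j; split=> [s0|xr].
  apply/eqP; have [//|/(out_arrow_exists (rt_rooted Q)) [a xa]] := eqVneq x (rt_root Q).
  by subst x; rewrite (diagram_forest_par j) in s0.
case e: (par _) => [t|] //; have [a [xa _]] := par_arrow e.
by have /eqP := src_neq_root (rt_rooted Q) a; rewrite -xa.
Qed.

End DiagramForest.

(** [step] moves a chosen representative of each class; the class of the result is the image under
    the induced map, whatever the choice. *)
Lemma H0_rep_framed (F : top_functor R Q) :
  exists2 S, total S & framed (H0_rep k F) S.
Proof.
have [s sP] := dependent_choice (fun x => H0_points_finite (F x)).
pose J x : finType := seq_sub (s x).
pose kappa x (u : F x) : J x := SeqSub ((sP x).1 u).
have kappa_surj x (j : J x) : exists u, kappa x u = j.
  have [u uj] := (sP x).2 _ (valP j); exists u; apply: val_inj; exact: uj.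
have kappa_pi x u v :
    kappa x u = kappa x v -> H0_pi << u >> = H0_pi << v >> :> H0 k (F x).
  exact: (congr1 val).
have kappa_simplex x (g : simplex1 R (F x)) : kappa x (g 0) = kappa x (g 1).
  by apply: val_inj; apply: H0_path; exists g.
have [eb /dependent_choice [cb ecP]] := dependent_choice (fun x =>
  H0_bases (@kappa_surj x) (@kappa_simplex x) (@kappa_pi x)).
pose r x := projT1 (choice (@kappa_surj x)).
have rK x j : kappa x (r x j) = j := projT2 (choice (@kappa_surj x)) j.
pose step a (j : J (src a)) : J (tgt a) :=
  kappa (tgt a) (tf_map F (qpath_arrow a) (r (src a) j)).
exists (diagram_forest step); first exact: diagram_forest_total.
apply: (@framing_of_bases k Q (H0_rep k F) (diagram_forest step) J
  (fun x j => Tagged J j) eb cb) => //.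
- by move=> x i j; apply: eq_from_Tagged.
- by move=> [x j]; exists j.
- by move=> x j; have [cb_lin _ _ _] := ecP x; apply: cb_lin.
- by move=> x i j; have [_ -> _ _] := ecP x.
- by move=> x v; have [_ _ -> _] := ecP x.
move=> a j; rewrite diagram_forest_par; exists (step a j) => //.
have [_ _ _ ebx] := ecP (tgt a); rewrite /step ebx.
have [_ _ _ ebx'] := ecP (src a).
by rewrite -[in LHS](rK (src a) j) ebx' [LHS]H0_map_point.
Qed.

End ZerothHomology.

(** * Realization by discrete spaces *)

Section Realization.
Variables (k : fieldType) (R : realType) (Q : rooted_tree_quiver).

Lemma discrete_continuous (X : discreteTopologicalType) (Y : topologicalType)
  (f : X -> Y) : continuous f.
Proof.
move=> x A Ax; apply: filterS (discrete_set1 x) => y ->.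
exact: nbhs_singleton Ax.
Qed.

(** Otherwise the indicator of [g 0] along [g] would go continuously from 1 to 0 without taking the
    value 1/2. *)
Lemma simplex_discrete (X : discreteTopologicalType) (g : simplex1 R X) : g 0 = g 1.
Proof.
apply: contrapT => g01.
pose ind (x : X) : R := if `[< x = g 0 >] then 1 else 0.
have ind_cont : continuous ind.
  exact: discrete_continuous.
pose f := ind \o g.
have f_cont : ({within `[0, 1], continuous f})%classic.
  move=> t; exact: (@continuous_comp _ X R (from_subspace `[0, 1]%classic g) ind t
    (@simplex1_cont R X g t) (ind_cont (g t))).
have f0 : f 0 = 1 by rewrite /f /ind /= asboolT.
have f1 : f 1 = 0 by rewrite /f /ind /= asboolF // => e; apply: g01.
have [|c _ fc] := @IVT R f 0 1 2^-1 ler01 f_cont.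
  by rewrite f0 f1 minElt maxElt ltNge ler01 /= invr_ge0 ler0n invf_le1 ?ler1n ?ltr0n.
have := fc; rewrite /f /ind /=; case: ifP => _ /eqP.
  by rewrite eq_sym invr_eq1 pnatr_eq1.
by rewrite eq_sym invr_eq0 pnatr_eq0.
Qed.

Section Space.
Variables (S : forest Q) (tot : total S).

Definition fiber_space x : topologicalType := discrete_topology {s : S | pos s == x}.

Fact fiber_space_fin x : finite_set (range (@path_component R (fiber_space x))).
Proof. exact/finite_image/(@finite_finset {s : S | pos s == x} setT). Qed.

Definition fiber_ftop x : ftop R := FTop (@fiber_space_fin x).

Fact fiber_step_subproof a (s : {s : S | pos s == src a}) :
  exists t : {s : S | pos s == tgt a}, par (val s) = Some (val t).
Proof.
case e: (par (val s)) => [t|].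
  have ta : pos t == tgt a by apply/eqP/(pos_par _ e)/eqP/(valP s).
  by exists (exist _ t ta).
move/(tot (val s)): e; rewrite (eqP (valP s)) => /eqP.
by rewrite (negPf (src_neq_root (rt_rooted Q) a)).
Qed.

Definition fiber_step a (s : {s : S | pos s == src a}) : {s : S | pos s == tgt a} :=
  projT1 (cid (fiber_step_subproof s)).

Lemma fiber_stepP a (s : {s : S | pos s == src a}) :
  par (val s) = Some (val (fiber_step s)).
Proof. exact: (projT2 (cid (fiber_step_subproof s))). Qed.

Fixpoint fiber_move x y (p : qpath x y) : fiber_space x -> fiber_space y :=
  match p with
  | qpath_id => id
  | qpath_rcons a p' => fun s => fiber_step (fiber_move p' s)
  end.

Fact fiber_move_cont x y (p : qpath x y) :
  continuous (fiber_move p : fiber_ftop x -> fiber_ftop y).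
Proof. exact: (@discrete_continuous (discrete_topology _)). Qed.

Fact fiber_move_cat x y z (p : qpath x y) (q : qpath y z) u :
  fiber_move (qpath_cat p q) u = fiber_move q (fiber_move p u).
Proof. by elim: q => //= a q ->. Qed.

Definition fiber_functor : top_functor R Q :=
  @TopFunctor R Q fiber_ftop (fun x y p => FTopHom (@fiber_move_cont x y p))
    (fun x u => erefl) fiber_move_cat.

(** In a discrete space each point is its own path component, so [H0_bases] applies with the
    identity as labelling. *)
Lemma framed_fiber_functor : framed (H0_rep k fiber_functor) S.
Proof.
pose J x : finType := {s : S | pos s == x}.
have pi_eq x (s t : fiber_ftop x) :
  s = t -> H0_pi << s >> = H0_pi << t >> :> H0 k (fiber_ftop x) by move=> ->.
have [eb /dependent_choice [cb ecP]] := dependent_choice (fun x =>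
  @H0_bases k R (fiber_ftop x) (J x) id (fun j => ex_intro _ j erefl)
    (@simplex_discrete (discrete_topology (J x))) (@pi_eq x)).
apply: (@framing_of_bases k Q (H0_rep k fiber_functor) S J
  (fun x j => val j) eb cb).
- by move=> x j; apply/eqP/(valP j).
- by move=> x; apply: val_inj.
- by move=> s; exists (exist _ s (eqxx _)).
- by move=> x j; have [cb_lin _ _ _] := ecP x; apply: cb_lin.
- by move=> x i j; have [_ -> _ _] := ecP x.
- by move=> x v; have [_ _ -> _] := ecP x.
move=> a j; rewrite fiber_stepP; exists (fiber_step j) => //.
have [_ _ _ ebx] := ecP (tgt a); have [_ _ _ ebx'] := ecP (src a).
by rewrite -[eb (src a) j]/(eb (src a) (id j)) ebx' [LHS]H0_map_point -ebx.
Qed.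

End Space.

Lemma rep_H0P (V : rep k Q) : rep_H0 R V <-> exists2 S, total S & framed V S.
Proof.
split=> [[F VF]|[S tot [F]]].
  have [S tot [G]] := H0_rep_framed k F; exists S => //.
  exact: framing_transport (rep_iso_sym VF) G.
exists (fiber_functor tot); have [G] := framed_fiber_functor tot.
exact: framing_iso F G.
Qed.

Section PointedForest.
Variable S : forest Q.

Let out x := [pick a : arrow Q | src a == x].

Let out_src a : out (src a) = Some a.
Proof.
rewrite /out; case: pickP => [b /eqP /(out_arrow_uniq (rt_rooted Q)) -> //|/(_ a)].
by rewrite eqxx.
Qed.

Let basepoint_par x : option (S + vertex Q) := omap (fun a => inr (tgt a)) (out x).

Let pointed_pos (s : S + vertex Q) := match s with inl s => pos s | inr x => x end.

Let pointed_par (s : S + vertex Q) := match s with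
  | inl s => if par s is Some t then Some (inl t) else basepoint_par (pos s)
  | inr x => basepoint_par x end.

Let basepoint_par_arrow x t : basepoint_par x = Some t ->
  exists a, x = src a /\ pointed_pos t = tgt a.
Proof.
by rewrite /basepoint_par /out; case: pickP => // a /eqP <- [<-]; exists a.
Qed.

Fact pointed_subproof s t : pointed_par s = Some t ->
  exists a, pointed_pos s = src a /\ pointed_pos t = tgt a.
Proof.
case: s => [s|x] /=; last exact: basepoint_par_arrow.
case e: (par s) => [u|]; last exact: basepoint_par_arrow.
by move=> [<-]; apply: par_arrow e.
Qed.

(* A base point is added over each vertex, and becomes the parent of the roots
   over the preceding vertices. *)
Definition pointed_forest : forest Q := Forest pointed_subproof.

Lemma pointed_forest_total : total pointed_forest.
Proof.
have base x : basepoint_par x = None <-> x = rt_root Q.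
  split=> [|xr]; last first.
    case e: (basepoint_par x) => [t|] //; have [a [xa _]] := basepoint_par_arrow e.
    by have /eqP := src_neq_root (rt_rooted Q) a; rewrite -xa.
  have [//|/(out_arrow_exists (rt_rooted Q)) [a <-]] := eqVneq x (rt_root Q).
  by rewrite /basepoint_par out_src.
case=> [s|x]; last exact: base.
rewrite -[pos _]/(pos s) -base [par _]/(pointed_par (inl s)) /=.
case e: (par s) => [t|] //; split=> // /base sr; have [a [sa _]] := par_arrow e.
by have /eqP := src_neq_root (rt_rooted Q) a; rewrite -sa.
Qed.

(** The base points span the constant summand, and each node vector is shifted by the base point
    [star] over its vertex. The arrow out of a root kills its own vector and keeps the shift, so the
    root is sent to the next base point. *)
Lemma framed_pointed (U V : rep k Q) :
  rep_iso U (rep_dsum (fun b : bool => if b then V else const_rep k Q)) ->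
  framed V S -> framed U pointed_forest.
Proof.
move=> /sum_decompositionP [i_ [p_ [pi pi0 ip]]] [F].
pose iV : rep_hom V U := i_ true; pose pV : rep_hom U V := p_ true.
pose iC : rep_hom (const_rep k Q) U := i_ false.
pose pC : rep_hom U (const_rep k Q) := p_ false.
have pViV x v : pV x (iV x v) = v by apply: (pi true).
have pCiC x v : pC x (iC x v) = v by apply: (pi false).
have pViC x v : pV x (iC x v) = 0 by apply: (pi0 true false).
have pCiV x v : pC x (iV x v) = 0 by apply: (pi0 false true).
have sumU x w : iV x (pV x w) + iC x (pC x w) = w by rewrite -[RHS]ip big_bool.
pose star x : U x := iC x (1 : k^o).
have iC_star x (z : k^o) : iC x z = z *: star x.
  by rewrite -linearZ; congr (iC x _); rewrite /GRing.scale /= mulr1.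
have map_star a : rep_map U a (star (src a)) = star (tgt a).
  by rewrite -rep_homE /= id_lfunE.
(* The multiple of [star x] carried by the shifted node vectors; the coordinate at the base point is
   corrected by it. *)
pose weight x v : k := \sum_s fc F s (v : V x).
have weight_lin x : scalar (@weight x).
  move=> c u v; rewrite /weight mulr_sumr -big_split.
  by apply: eq_bigr => s _; rewrite linearP.
have weight_fb x s : pos s = x -> weight x (fb F x s) = 1.
  move=> sx; rewrite /weight (bigD1 s) //= fc_fb // eqxx big1 ?addr0 // => t ts.
  by rewrite fc_fb // (negPf ts).
have weight0 x : weight x 0 = 0.
  by rewrite /weight big1 // => s _; rewrite linear0.
pose e x (s : pointed_forest) : U x := match s with
  | inl s => iV x (fb F x s) + (pos s == x)%:R *: star x
  | inr y => (y == x)%:R *: star x end.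
pose c x (s : pointed_forest) (w : U x) : k := match s with
  | inl s => fc F s (pV x w)
  | inr y => (y == x)%:R * ((pC x w : k) - weight x (pV x w)) end.
have base_par a : basepoint_par (src a) = Some (inr (tgt a)).
  by rewrite /basepoint_par out_src.
split; apply: (@Framing k Q U pointed_forest e c).
- move=> x [s|y] b u v; first by rewrite /= !linearP.
  rewrite /= !linearP weight_lin mulrCA -mulrDr; congr (_ * _).
  by rewrite opprD addrACA mulrBr.
- move=> x [s|y] sx; rewrite /= (negPf sx) scale0r // addr0.
  by rewrite fb_off // linear0.
- move=> x [s|y] [t|z] /= tx; rewrite tx eqxx scale1r ?linearD /=.
  + by rewrite pViV pViC linear0 addr0 fc_fb.
  + by rewrite pViC linear0.
  + by rewrite pCiV pCiC add0r pViV pViC addr0 weight_fb // subrr mulr0.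
  + by rewrite pCiC pViC weight0 subr0 mulr1.
- move=> x w; rewrite -[RHS]sumU big_sumType /= iC_star.
  under eq_bigr do rewrite scalerDr.
  rewrite big_split /= -addrA; congr (_ + _).
    rewrite -[in RHS](fb_sum F (pV x w)) linear_sum.
    by apply: eq_bigr => s _; rewrite linearZ.
  rewrite (bigD1 x) //= eqxx mul1r scale1r [X in _ + (_ + X)]big1 ?addr0; last first.
    by move=> y /negPf ->; rewrite scale0r scaler0.
  rewrite scalerBl addrC -[RHS]subr0 -addrA; congr (_ + _).
  rewrite oppr0 addrC; apply/eqP; rewrite subr_eq0 /weight scaler_suml; apply/eqP.
  apply: eq_bigr => s _; have [sx|sx] := eqVneq (pos s) x; first by rewrite scale1r.
  by rewrite (fc_off F _ sx) !scale0r.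
move=> a [s|y] /= sa; last first.
  by rewrite sa base_par /= !eqxx !scale1r map_star.
rewrite sa eqxx scale1r linearD /= map_star -rep_homE fb_map // base_par.
case es: (par s) => [t|] /=; last by rewrite linear0 add0r eqxx scale1r.
by rewrite (pos_par sa es) eqxx scale1r.
Qed.

End PointedForest.

Lemma rooted_tree_module_summand (W : rep k Q) : rooted_tree_module W ->
  exists2 V, rep_H0 R V & direct_summand W V.
Proof.
move=> /rooted_tree_module_tree_like [S [r [WS _]]].
exists (rep_dsum (fun b : bool => if b then W else const_rep k Q)).
  apply/rep_H0P; exists (pointed_forest S); first exact: pointed_forest_total.
  exact: framed_pointed (rep_iso_refl _) WS.
by exists (const_rep k Q); apply: rep_iso_refl.
Qed.

End Realization.

Theorem theoremA (R : realType) (k : fieldType) (Q : rooted_tree_quiver) :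
  (forall V : rep k Q,
     rep_H0 R V <-> finite_sum_of (@linearized_rooted_tree k Q) V) /\
  (forall V : rep k Q,
     add_closure (@rep_H0 R k Q) V <-> finite_sum_of (@rooted_tree_module k Q) V).
Proof.
split=> V.
  rewrite rep_H0P; split=> [[S tot VS]|]; first exact: framed_sum_linearized tot VS.
  exact: sum_linearized_framed.
rewrite /add_closure !finite_sum_ofP; split; last first.
  exact/sums_of_sub/rooted_tree_module_summand.
move=> VW; apply: sums_of_sums; apply: sums_of_sub VW => W [U /rep_H0P [S _ US] WU].
apply: (sums_of_sub (@tree_like_rooted_tree_module k Q)).
exact: summand_tree_like US WU.
Qed.
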